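(* Let $\mathcal{P}$ be an imprecise probability tree and $\overline{\mathrm{Q}}$ an upper expectation tree that agree. Let $s\in\mathcal{X}^*$ be any situation and let $f\in\overline{\mathbb{V}}_{\mathrm b}$ be any $\mathcal{F}$-measurable global variable that is bounded below. Then $\overline{\mathrm{E}}_{\mathcal{P}}(f\mid s)=\overline{\mathrm{E}}_{\overline{\mathrm{Q}}}(f\mid s)$.
   Context: **Basics.** $\mathcal{X}$ is a fixed non-empty finite set (state space), $\mathbb{N}=\{1,2,\dots\}$, $\mathbb{N}_0=\mathbb{N}\cup\{0\}$. A situation is a finite sequence $x_{1:k}=x_1\cdots x_k\in\mathcal{X}^k$, $k\in\mathbb{N}_0$; $\mathcal{X}^*=\bigcup_{k\in\mathbb{N}_0}\mathcal{X}^k$ is the set of all situations and $\square=x_{1:0}$ is the empty one. $\Omega=\mathcal{X}^{\mathbb{N}}$ is the set of paths; for $\omega=x_1x_2\cdots\in\Omega$, $\omega^k=x_{1:k}$. $\Gamma(x_{1:k})=\{\omega\in\Omega:\omega^k=x_{1:k}\}$ is a cylinder event, and $\mathcal{F}$ is the $\sigma$-algebra on $\Omega$ generated by all cylinder events. $\overline{\mathbb{R}}=\mathbb{R}\cup\{\pm\infty\}$. A variable on a non-empty set $Y$ is a map $Y\to\overline{\mathbb{R}}$; a gamble is a bounded (hence real-valued) variable. $\mathcal{L}(\mathcal{X})$ is the set of all maps $\mathcal{X}\to\mathbb{R}$; $\overline{\mathbb{V}}$ and $\mathbb{V}$ are the sets of all variables, respectively all gambles, on $\Omega$ (global variables, global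 gambles); $\overline{\mathbb{V}}_{\mathrm b}$ is the set of all bounded below elements of $\overline{\mathbb{V}}$. A global variable $f$ is finitary if there are $n\in\mathbb{N}$ and $g:\mathcal{X}^n\to\overline{\mathbb{R}}$ with $f(\omega)=g(\omega^n)$ for all $\omega$; $\mathbb{F}$ is the set of finitary gambles. $X_n$ is the projection $\omega\mapsto\omega_n$ (the $n$-th state value) and $X_{1:n}$ the projection $\omega\mapsto\omega^n$. $\mathbb{I}_s$ is the indicator of $\Gamma(s)$. Limits and inequalities of variables are pointwise. A global upper expectation is a map $\overline{\mathrm{E}}:\overline{\mathbb{V}}\times\mathcal{X}^*\to\overline{\mathbb{R}}$, $(f,s)\mapsto\overline{\mathrm{E}}(f\mid s)$. **Trees.** A precise probability tree $p$ assigns to each $s\in\mathcal{X}^*$ a probability mass function $p(\cdot\mid s)$ on $\mathcal{X}$. An imprecise probability tree $\mathcal{P}$ assigns to each $s\in\mathcal{X}^*$ a credal set $\mathcal{P}_s$, i.e. a non-empty closed (for pointwise convergence) convex set of probability mass functions on $\mathcal{X}$. $p$ is compatible with $\mathcal{P}$, written $p\sim\mathcal{P}$, if $p(\cdot\mid s)\in\mathcal{P}_s$ for all $s$. An upper expectation tree $\overline{\mathrm{Q}}$ assigns to each $s\in\mathcal{X}^*$ a map $\overline{\mathrm{Q}}_s:\mathcal{L}(\mathcal{X})\to\mathbb{R}$ such that $\overline{\mathrm{Q}}_s(f)\le\sup f$, $\overline{\mathrm{Q}}_s(f+g)\le\overline{\mathrm{Q}}_s(f)+\overline{\mathrm{Q}}_s(g)$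 and $\overline{\mathrm{Q}}_s(\lambda f)=\lambda\overline{\mathrm{Q}}_s(f)$ for all $f,g\in\mathcal{L}(\mathcal{X})$ and real $\lambda\ge0$. $\mathcal{P}$ and $\overline{\mathrm{Q}}$ agree if $\overline{\mathrm{Q}}_s(f)=\sup\{\sum_{x\in\mathcal{X}}f(x)p(x\mid s):p(\cdot\mid s)\in\mathcal{P}_s\}$ for all $s\in\mathcal{X}^*$ and $f\in\mathcal{L}(\mathcal{X})$; equivalently, for all $s$, $\mathcal{P}_s$ is the set of all mass functions $q$ on $\mathcal{X}$ with $\sum_x f(x)q(x)\le\overline{\mathrm{Q}}_s(f)$ for all $f\in\mathcal{L}(\mathcal{X})$ (this is a one-to-one correspondence). **Measure-theoretic upper expectation $\overline{\mathrm{E}}_{\mathcal{P}}$.** For a precise tree $p$ and a situation $x_{1:k}$, $\mathrm{P}_p(\cdot\mid x_{1:k})$ is the unique probability measure on $\mathcal{F}$ such that, for every situation $z_{1:\ell}$, $\mathrm{P}_p(\Gamma(z_{1:\ell})\mid x_{1:k})$ equals $\prod_{i=k}^{\ell-1}p(z_{i+1}\mid z_{1:i})$ if $k<\ell$ and $z_{1:k}=x_{1:k}$; equals $1$ if $k\ge\ell$ and $z_{1:\ell}=x_{1:\ell}$; and equals $0$ otherwise. $\mathrm{E}_p(f\mid s)=\int_\Omega f\,d\mathrm{P}_p(\cdot\mid s)$ whenever this Lebesgue integral exists (in particular if $f$ is $\mathcal{F}$-measurable and bounded below or bounded above). For all $f\in\overline{\mathbb{V}}$, $\overline{\mathrm{E}}_p(f\mid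 s)=\inf\{\mathrm{E}_p(g\mid s): g\in\overline{\mathbb{V}}\text{ bounded below and }\mathcal{F}\text{-measurable},\ g\ge f\}$, and $\overline{\mathrm{E}}_{\mathcal{P}}(f\mid s)=\sup\{\overline{\mathrm{E}}_p(f\mid s):p\sim\mathcal{P}\}$. **Game-theoretic/axiomatic upper expectation $\overline{\mathrm{E}}_{\overline{\mathrm{Q}}}$.** A supermartingale (for $\overline{\mathrm{Q}}$) is a map $\mathcal{M}:\mathcal{X}^*\to\mathbb{R}$ with $\overline{\mathrm{Q}}_s(\mathcal{M}(s\,\cdot))\le\mathcal{M}(s)$ for all $s$, where $\mathcal{M}(s\,\cdot)$ is $x\mapsto\mathcal{M}(sx)$; $\mathbb{M}_{\mathrm b}(\overline{\mathrm{Q}})$ is the set of bounded below supermartingales; $\liminf\mathcal{M}(\omega)=\liminf_{k\to\infty}\mathcal{M}(\omega^k)$. For a global gamble $f\in\mathbb{V}$ put $\overline{\mathrm{E}}_{\mathrm{G},\overline{\mathrm{Q}}}(f\mid s)=\inf\{\mathcal{M}(s):\mathcal{M}\in\mathbb{M}_{\mathrm b}(\overline{\mathrm{Q}}),\ \liminf\mathcal{M}(\omega)\ge f(\omega)\text{ for all }\omega\in\Gamma(s)\}$. This is extended uniquely to $\overline{\mathbb{V}}\times\mathcal{X}^*$ by $\overline{\mathrm{E}}_{\mathrm{G},\overline{\mathrm{Q}}}(f\mid s)=\lim_{c\to+\infty}\overline{\mathrm{E}}_{\mathrm{G},\overline{\mathrm{Q}}}(\min\{f,c\}\mid s)$ for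 $f\in\overline{\mathbb{V}}_{\mathrm b}$, and $\overline{\mathrm{E}}_{\mathrm{G},\overline{\mathrm{Q}}}(f\mid s)=\lim_{c\to-\infty}\overline{\mathrm{E}}_{\mathrm{G},\overline{\mathrm{Q}}}(\max\{f,c\}\mid s)$ for $f\in\overline{\mathbb{V}}$. The axiomatic model $\overline{\mathrm{E}}_{\mathrm{A},\overline{\mathrm{Q}}}$ is the (pointwise) largest global upper expectation $\overline{\mathrm{E}}$ satisfying: P1. $\overline{\mathrm{E}}(f(X_{n+1})\mid x_{1:n})=\overline{\mathrm{Q}}_{x_{1:n}}(f)$ for all $f\in\mathcal{L}(\mathcal{X})$, $x_{1:n}\in\mathcal{X}^*$; P2. $\overline{\mathrm{E}}(f\mid s)=\overline{\mathrm{E}}(f\mathbb{I}_s\mid s)$ for all $f\in\mathbb{F}$, $s\in\mathcal{X}^*$; P3. $\overline{\mathrm{E}}(f\mid X_{1:k})\le\overline{\mathrm{E}}(\overline{\mathrm{E}}(f\mid X_{1:k+1})\mid X_{1:k})$ for all $f\in\mathbb{F}$, $k\in\mathbb{N}_0$, where $\overline{\mathrm{E}}(f\mid X_{1:k})$ is the variable $\omega\mapsto\overline{\mathrm{E}}(f\mid\omega^k)$; P4. $f\le g$ implies $\overline{\mathrm{E}}(f\mid s)\le\overline{\mathrm{E}}(g\mid s)$ for all $f,g\in\overline{\mathbb{V}}$, $s\in\mathcal{X}^*$; P5. for any sequence $(f_n)$ of finitary gambles that is uniformly bounded below and converges pointwise to $f$, $\limsup_n\overline{\mathrm{E}}(f_n\mid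 s)\ge\overline{\mathrm{E}}(f\mid s)$ for all $s\in\mathcal{X}^*$. It is known (earlier work) that this largest model exists and that $\overline{\mathrm{E}}_{\mathrm{A},\overline{\mathrm{Q}}}=\overline{\mathrm{E}}_{\mathrm{G},\overline{\mathrm{Q}}}$; the common operator is denoted $\overline{\mathrm{E}}_{\overline{\mathrm{Q}}}$. *)

(* Defs.v *)
From HB Require Import structures.
From mathcomp Require Import all_boot all_order all_algebra.
From mathcomp Require Import all_classical all_reals all_analysis.
From mathcomp Require Import measurable_realfun.

Set Implicit Arguments.
Unset Strict Implicit.
Unset Printing Implicit Defensive.

Import Order.TTheory GRing.Theory Num.Theory.
Import numFieldNormedType.Exports.

Local Open Scope classical_set_scope.
Local Open Scope ring_scope.

(* Non-empty finite sets. [point] witnesses non-emptiness and only ever serves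
   as a junk value below. *)
#[short(type="finPointedType")]
HB.structure Definition FinPointed := {T of Finite T & isPointed T}.

(* A situation x_1 ... x_k is the list [:: x_1; ...; x_k]; paths are indexed
   from 0, so that [w i] is the (i+1)-th state. *)
Definition prefix_of (X : Type) (w : nat -> X) (k : nat) : seq X := mkseq w k.

Definition cylinder (X : Type) (s : seq X) : set (nat -> X) :=
  [set w | prefix_of w (size s) = s].

Definition path_space (X : finPointedType) :
    measurableType (range (@cylinder X)).-sigma :=
  g_sigma_algebraType (range (@cylinder X)).

Section Trees.
Context {R : realType} {X : finPointedType}.

Definition is_pmf (q : X -> R) : Prop :=
  (forall x, 0 <= q x) /\ \sum_(x : X) q x = 1.

Definition is_credal_set (C : set (X -> R)) : Prop :=
  [/\ C !=set0,
      closed (C : set {ptws X -> R}),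
      convex_set (C : set (convex_lmodType (X -> R))) &
      forall q, C q -> is_pmf q].

Definition is_imprecise_tree (P : seq X -> set (X -> R)) : Prop :=
  forall s, is_credal_set (P s).

Definition compatible (p : seq X -> X -> R) (P : seq X -> set (X -> R)) : Prop :=
  forall s, P s (p s).

Definition is_upper_expectation (Q : (X -> R) -> R) : Prop :=
  [/\ forall f, Q f <= sup (range f),
      forall f g, Q (fun x => f x + g x) <= Q f + Q g &
      forall (a : R) f, 0 <= a -> Q (fun x => a * f x) = a * Q f].

Definition is_upper_expectation_tree (Q : seq X -> (X -> R) -> R) : Prop :=
  forall s, is_upper_expectation (Q s).

Definition agree (P : seq X -> set (X -> R)) (Q : seq X -> (X -> R) -> R) : Prop :=
  forall s f, (Q s f)%:E = ereal_sup [set (\sum_(x : X) f x * q x)%:E | q in P s].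

Definition bounded_below (T : Type) (f : T -> \bar R) : Prop :=
  exists c : R, forall w, (c%:E <= f w)%E.

End Trees.

Section MeasureTheoretic.
Context {R : realType} {X : finPointedType}.

Definition cylinder_prob (p : seq X -> X -> R) (s z : seq X) : R :=
  if (size s < size z)%N && (take (size s) z == s) then
    \prod_(size s <= i < size z) p (take i z) (nth point z i)
  else if (size z <= size s)%N && (take (size z) s == z) then 1
  else 0.

(* When every [p s] is a mass function, exactly one probability measure has
   these values on the cylinders, and [get] selects it. *)
Definition path_measure (p : seq X -> X -> R) (s : seq X) :
    probability (path_space X) R :=
  get [set mu : probability (path_space X) R |
        forall z, mu (cylinder z) = (cylinder_prob p s z)%:E].

Definition upper_Ep (p : seq X -> X -> R) (f : path_space X -> \bar R)
    (s : seq X) : \bar R :=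
  ereal_inf [set \int[path_measure p s]_(w in setT) g w |
    g in [set g : path_space X -> \bar R |
           [/\ bounded_below g, measurable_fun setT g &
               forall w, (f w <= g w)%E]]]%E.

Definition upper_EP (P : seq X -> set (X -> R)) (f : path_space X -> \bar R)
    (s : seq X) : \bar R :=
  ereal_sup [set upper_Ep p f s | p in [set p | compatible p P]].

End MeasureTheoretic.

Section GameTheoretic.
Context {R : realType} {X : finPointedType}.
Implicit Types (Q : seq X -> (X -> R) -> R) (f : path_space X -> \bar R).

Definition supermartingale Q (M : seq X -> R) : Prop :=
  forall s, Q s (fun x => M (rcons s x)) <= M s.

(* The game-theoretic upper expectation of bounded f; the two definitions after
   it extend it, first to variables that are bounded below and then to all
   variables. They apply the preceding one to truncated variables only. *)
Definition upper_EG_gamble Q f (s : seq X) : \bar R :=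
  ereal_inf [set (M s)%:E | M in [set M : seq X -> R |
    [/\ supermartingale Q M,
        exists c : R, forall t, c <= M t &
        forall w, cylinder s w ->
          (f w <= limn_einf (fun k => (M (prefix_of w k))%:E))%E]]].

Definition upper_EG_bounded_below Q f (s : seq X) : \bar R :=
  lim (upper_EG_gamble Q (fun w => mine (f w) c%:E) s @[c --> +oo%R]).

(* This operator coincides with the largest global upper expectation that
   satisfies the coherence and finitary-continuity axioms. *)
Definition upper_EQ Q f (s : seq X) : \bar R :=
  lim (upper_EG_bounded_below Q (fun w => maxe (f w) c%:E) s @[c --> -oo%R]).

End GameTheoretic.

(* Main.v *)
From HB Require Import structures.
Require Import Defs.
From mathcomp Require Import all_boot all_order all_algebra.
From mathcomp Require Import all_classical all_reals all_analysis.
From mathcomp Require Import measurable_realfun.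
From mathcomp Require Import lra.

(* For one inequality, Fatou's lemma along a precise tree [p] turns a bounded
   below supermartingale whose limit inferior dominates [f] into a bound on the
   integral of [f]. Truncating and rescaling, it remains to bound the
   game-theoretic upper expectation [cap] of a measurable [f] with values in
   [0, 1] by the integrals of [f].

   Switching between supermartingales at stopping situations gives a zero-one
   law: the limit inferior of [cap f] along a path is at least [f], up to a null
   set. Hence [cap] is continuous along increasing sequences of arbitrary
   functions. A measurable [f] is the supremum over [sigma] in [nat -> nat] of an
   upper semicontinuous function of the path and [sigma], so Choquet's argument
   yields [g <= f], the decreasing limit of finitary [K_k], with
   [cap K_k > cap f - e] for all [k]. The limit [W] in [k] of the backward
   recursions of the [K_k] satisfies [W t <= Q t (W (t .))], and choosing each
   [p t] in [P t] nearly optimal for [W] makes the integral of [g] at least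
   [cap f - 2 e]. *)

Set Implicit Arguments.
Unset Strict Implicit.
Unset Printing Implicit Defensive.

Import Order.TTheory GRing.Theory Num.Theory.
Import numFieldNormedType.Exports.

Local Open Scope classical_set_scope.
Local Open Scope ring_scope.

(** * Prefixes of paths and upper expectations on a finite set *)

Section Prefixes.
Context {X : Type}.
Implicit Types (w : nat -> X) (s t : seq X).

Lemma size_prefix_of w k : size (prefix_of w k) = k.
Proof. exact: size_mkseq. Qed.

Lemma prefix_ofS w k : prefix_of w k.+1 = rcons (prefix_of w k) (w k).
Proof. exact: mkseqS. Qed.

Lemma take_prefix_of w j k : (j <= k)%N -> take j (prefix_of w k) = prefix_of w j.
Proof. by move=> jk; rewrite /prefix_of /mkseq -map_take take_iota (minn_idPl jk). Qed.

Lemma cylinder_prefix_of w k : cylinder (prefix_of w k) w.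
Proof. by rewrite /cylinder /= size_prefix_of. Qed.

Lemma cylinderE s w : cylinder s w -> prefix_of w (size s) = s.
Proof. by []. Qed.

Lemma cylinder_rconsW s x : cylinder (rcons s x) `<=` cylinder s.
Proof.
by move=> w; rewrite /cylinder /= size_rcons prefix_ofS => /rcons_inj[].
Qed.

End Prefixes.

(** The largest of the finitely many thresholds works for all [x]. This is what lets limits along
    [n] pass through [Q t], which only sees the finitely many children of [t]. *)
Lemma finite_eventually (T : finType) (P : T -> nat -> Prop) :
  (forall x, exists n, forall m, (n <= m)%N -> P x m) ->
  exists n, forall x, P x n.
Proof.
move=> /choice[n nP]; exists (\max_x n x)%N => x.
by apply: nP; exact: leq_bigmax.
Qed.

Section UpperExpectations.
Context {R : realType} {X : finPointedType} (E : (X -> R) -> R)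
  (hE : is_upper_expectation E).

Lemma upper_le_bound f c : (forall x, f x <= c) -> E f <= c.
Proof.
move=> fc; case: hE => + _ _; move=> /(_ f)/le_trans; apply.
by apply: ge_sup; [exists (f point), point|move=> _ [x _ <-]].
Qed.

(** Subadditivity on [f = g + (f - g)]. Monotonicity is the case [c = 0], and a uniform error passes
    through [E] unchanged. *)
Lemma upper_le_shift f g c : (forall x, f x <= g x + c) -> E f <= E g + c.
Proof.
move=> fgc; case: hE => _ Esub _.
have -> : f = (fun x => g x + (f x - g x)) by apply/funext => x; rewrite addrC subrK.
apply: le_trans (Esub _ _) _; rewrite lerD2l; apply: upper_le_bound => x.
by rewrite lerBlDl.
Qed.

Lemma upper_mono f g : (forall x, f x <= g x) -> E f <= E g.
Proof.
by move=> fg; rewrite -[leRHS]addr0; apply: upper_le_shift => x; rewrite addr0.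
Qed.

Lemma upper_add f g : E (fun x => f x + g x) <= E f + E g.
Proof. by case: hE. Qed.

Lemma upper_scale a f : 0 <= a -> E (fun x => a * f x) = a * E f.
Proof. by case: hE => _ _; apply. Qed.

End UpperExpectations.

(** * Analytic sets *)

(** Dependent choice along finite sequences, used for König's lemma, for Choquet's bounds and for
    nested intervals. *)
Lemma seq_extend (T : choiceType) (P : seq T -> Prop) :
  P [::] -> (forall u, P u -> exists j, P (rcons u j)) ->
  exists nu : nat -> T, forall n, P (mkseq nu n).
Proof.
move=> P0 PS.
(* [j0] is only a default, for sequences that fail [P]. *)
have [j0 _] := PS _ P0.
have /choice[next nextP] u : exists j, P u -> P (rcons u j).
  by have [/PS[j Pj]|nPu] := pselect (P u); [exists j|exists j0].
pose fix tau n := if n is m.+1 then rcons (tau m) (next (tau m)) else [::].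
exists (next \o tau) => n.
have -> : mkseq (next \o tau) n = tau n by elim: n => // n IH; rewrite mkseqS IH.
by elim: n => //= n IH; exact: nextP.
Qed.

Section Analytic.
Context {X : Type}.
Implicit Types (C : (nat -> X) -> (nat -> nat) -> Prop) (A : set (nat -> X)).

Lemma eq_prefix_of (w w' : nat -> X) k :
  (forall i, (i < k)%N -> w' i = w i) -> prefix_of w' k = prefix_of w k.
Proof. by move=> ww'; apply/eq_in_map => i; rewrite mem_iota add0n; exact: ww'. Qed.

(* [C] is closed for the product of the discrete topologies. *)
Definition seq_closed C := forall w sigma,
  (forall m, exists w' sigma', [/\ forall i, (i < m)%N -> w' i = w i,
    forall i, (i < m)%N -> sigma' i = sigma i & C w' sigma']) ->
  C w sigma.

Definition analytic A :=
  exists2 C, seq_closed C & forall w, A w <-> exists sigma, C w sigma.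

Lemma analytic_finitary (D : set (seq X)) k :
  analytic [set w | D (prefix_of w k)].
Proof.
exists (fun w _ => D (prefix_of w k)) => [w sigma /(_ k)[w' [_ [ww' _]]]|w].
  by rewrite (eq_prefix_of ww').
by split=> [Dw|[]//]; exists id.
Qed.

(** The first coordinate of the witness names the set, and its tail is a witness for that set. *)
Lemma analytic_bigcup (A : nat -> set (nat -> X)) :
  (forall i, analytic (A i)) -> analytic (\bigcup_i A i).
Proof.
move=> anA; have /choice[C CP] i : exists C, seq_closed C /\
    forall w, A i w <-> exists sigma, C w sigma.
  by have [C cC AC] := anA i; exists C.
exists (fun w sigma => C (sigma 0%N) w (sigma \o S)) => [w sigma sigmaC|w].
  (* One coordinate more than [m]: the tail is shifted by one, and the first coordinates must agree
     so that both witnesses name the same set. *)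
  apply: (CP _).1 => m; have [w' [sigma' [ww' ss' C']]] := sigmaC m.+1.
  exists w', (sigma' \o S); rewrite -(ss' 0%N)//; split=> // i im.
  - by apply: ww'; exact: ltnW.
  - exact: ss'.
split=> [[i _ /(CP i).2[sigma Csigma]]|[sigma Csigma]].
  by exists (fun n => if n is m.+1 then sigma m else i).
by exists (sigma 0%N) => //; apply/(CP _).2; eexists; exact: Csigma.
Qed.

(** One sequence carries the witnesses for all the sets, coordinate [k] of the [i]-th being stored
    at the code of [(i, k)]. *)
Lemma analytic_bigcap (A : nat -> set (nat -> X)) :
  (forall i, analytic (A i)) -> analytic (\bigcap_i A i).
Proof.
move=> anA; have /choice[C CP] i : exists C, seq_closed C /\
    forall w, A i w <-> exists sigma, C w sigma.
  by have [C cC AC] := anA i; exists C.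
exists (fun w sigma => forall i, C i w (fun k => sigma (pickle (i, k)))).
  move=> w sigma sigmaC i; apply: (CP _).1 => m.
  (* Large enough to cover the codes of the first [m] coordinates of the [i]-th witness. *)
  pose m' := maxn m (\max_(k < m) (pickle (i, val k)).+1).
  have [w' [sigma' [ww' ss' C']]] := sigmaC m'.
  exists w', (fun k => sigma' (pickle (i, k))); split=> // k km.
  - by apply: ww'; rewrite leq_max km.
  - apply: ss'; rewrite leq_max; apply/orP; right.
    exact: (@leq_bigmax_cond _ _ (fun k => (pickle (i, val k)).+1) (Ordinal km)).
move=> w; split=> [Aw|[sigma Csigma] i _]; last by apply/(CP _).2; eexists; exact: Csigma.
have /choice[sigma sP] i : exists sigma, C i w sigma by apply/(CP _).2; exact: Aw.
exists (fun n => if unpickle n is Some (i, k) then sigma i k else 0%N) => i.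
by under eq_fun do rewrite pickleK; exact: sP.
Qed.

(** The witnesses lie below [nu], so their coordinates branch finitely: a limit point exists, and
    closedness of [C] makes it a witness for [w]. *)
Lemma koenig C (nu : nat -> nat) w : seq_closed C ->
  (forall k, exists w' sigma, [/\ forall i, (i < k)%N -> w' i = w i,
    forall i, (i < k)%N -> (sigma i <= nu i)%N & C w' sigma]) ->
  exists sigma, C w sigma.
Proof.
move=> cC /choice[w_ /choice[s_ sP]].
(* A sequence is kept when arbitrarily late witnesses start with it. *)
pose good u := forall k, exists2 k', (k <= k')%N & mkseq (s_ k') (size u) = u.
have [||sigma sigmaP] := @seq_extend _ good.
- by move=> k; exists k.
- move=> u gu; apply: contrapT => /forallNP bad.
  have /choice[k_ kP] j : exists k, forall k', (k <= k')%N ->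
      mkseq (s_ k') (size u).+1 <> rcons u j.
    have /existsNP[k kP] := bad j; exists k => k' kk' uj; apply: kP.
    by exists k' => //; rewrite size_rcons.
  (* If no extension of [u] were good, each of the finitely many values up to [nu (size u)] would be
     abandoned after some [k_ j]; a witness later than all of these contradicts this. *)
  have [k'] := gu (maxn (size u).+1 (\max_(j < (nu (size u)).+1) k_ j)%N).
  rewrite geq_max => /andP[uk kk'] uE.
  have [_ snu _] := sP k'; have := snu _ uk; rewrite -ltnS => jnu.
  apply: (kP (s_ k' (size u)) k'); last by rewrite mkseqS uE.
  by apply: leq_trans kk'; exact: (@leq_bigmax_cond _ _ (fun j => k_ (val j)) (Ordinal jnu)).
exists sigma; apply: cC => m; have [k mk sE] := sigmaP m m.
have [ww' _ Ck] := sP k; exists (w_ k), (s_ k); split=> // i im.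
- by apply: ww'; exact: leq_trans mk.
- have := congr1 (fun u => nth 0%N u i) sE.
  by rewrite size_mkseq !nth_mkseq.
Qed.

End Analytic.

(** The sets that are analytic together with their complement form a sigma-algebra, which contains
    the cylinders since these depend on finitely many coordinates. *)
Lemma measurable_analytic (X : finPointedType) (A : set (path_space X)) :
  measurable A -> analytic A.
Proof.
move=> mA; suff : [set A : set (nat -> X) | analytic A /\ analytic (~` A)] A by case.
apply: mA; split; last by move=> _ [z _ <-]; split;
  [exact: (analytic_finitary [set z])|exact: (analytic_finitary (~` [set z]))].
split=> [|B [aB aNB]|B aB].
- split; [exact: (analytic_finitary set0 0)|rewrite setC0; exact: (analytic_finitary setT 0)].
- by split=> /=; rewrite setTD ?setCK.
- split; rewrite ?setC_bigcup; [apply: analytic_bigcup|apply: analytic_bigcap] => i;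
    by case: (aB i).
Qed.

(* A closed set whose projection is the strict subgraph of [f], up to rational
   heights, which are read off the first coordinate. *)
Lemma analytic_subgraph (R : realType) (X : finPointedType) (f : path_space X -> R) :
  (forall r, measurable [set w | r < f w]) ->
  exists C (q : nat -> R), [/\ seq_closed C,
    forall w sigma, C w sigma -> q (sigma 0%N) < f w &
    forall w a, a < f w -> exists2 sigma, C w sigma & a < q (sigma 0%N)].
Proof.
move=> mf; pose q i : R := if unpickle i is Some p then ratr p else 0.
have /choice[C CP] i : exists C, seq_closed C /\
    forall w, q i < f w <-> exists sigma, C w sigma.
  by have [C cC AC] := measurable_analytic (mf (q i)); exists C.
exists (fun w sigma => C (sigma 0%N) w (sigma \o S)), q; split.
- move=> w sigma sigmaC.
  apply: (CP _).1 => m; have [w' [sigma' [ww' ss' C']]] := sigmaC m.+1.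
  exists w', (sigma' \o S); rewrite -(ss' 0%N)//; split=> // i im.
  + by apply: ww'; exact: ltnW.
  + exact: ss'.
- by move=> w sigma Cw; apply/(CP _).2; eexists; exact: Cw.
- move=> w a /rat_in_itvoo[p]; rewrite in_itv /= => /andP[ap pf].
  have qE : q (pickle p) = ratr p by rewrite /q pickleK.
  have /(CP _).2[sigma Csigma] : q (pickle p) < f w by rewrite qE.
  by exists (fun n => if n is m.+1 then sigma m else pickle p); rewrite //= qE.
Qed.

(** * Game-theoretic capacity *)

Section Capacity.
Context {R : realType} {X : finPointedType} (Q : seq X -> (X -> R) -> R)
  (hQ : is_upper_expectation_tree Q).
Implicit Types (M N : seq X -> R) (f g : (nat -> X) -> R) (s t u : seq X).

Definition nonneg_supermartingale M :=
  supermartingale Q M /\ forall t, 0 <= M t.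

(* On [cylinder s], [f] is at most the limit inferior of [M] along the path. *)
Definition covers M f s := forall w, cylinder s w -> forall a, a < f w ->
  exists n, forall k, (n <= k)%N -> a <= M (prefix_of w k).

(* Restricting the game-theoretic upper expectation to nonnegative
   supermartingales makes it real-valued on functions bounded by 1. *)
Definition cap f s : R :=
  inf [set M s | M in [set M | nonneg_supermartingale M /\ covers M f s]].

Lemma nonneg_supermartingale_cst c : 0 <= c -> nonneg_supermartingale (fun=> c).
Proof. by move=> c0; split=> // t; exact: (upper_le_bound (hQ t)). Qed.

Lemma nonneg_supermartingaleD M N : nonneg_supermartingale M ->
  nonneg_supermartingale N -> nonneg_supermartingale (fun t => M t + N t).
Proof.
move=> [sM M0] [sN N0]; split=> [t|t]; last by rewrite addr_ge0.
by apply: le_trans (upper_add (hQ t) _ _) _; rewrite lerD.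
Qed.

Lemma nonneg_supermartingaleZ c M : 0 <= c -> nonneg_supermartingale M ->
  nonneg_supermartingale (fun t => c * M t).
Proof.
move=> c0 [sM M0]; split=> [t|t]; last by rewrite mulr_ge0.
by rewrite (upper_scale (hQ t))// ler_wpM2l.
Qed.

Lemma nonneg_supermartingale_min c M : 0 <= c -> nonneg_supermartingale M ->
  nonneg_supermartingale (fun t => Num.min (M t) c).
Proof.
move=> c0 [sM M0]; split=> [t|t]; last by rewrite le_min M0.
rewrite le_min; apply/andP; split.
  by apply: le_trans (sM t); apply: (upper_mono (hQ t)) => x; rewrite ge_min lexx.
by apply: (upper_le_bound (hQ t)) => x; rewrite ge_min lexx orbT.
Qed.

(** At the finitely many children of [t], a single [M n] comes within [e] of the supremum, and [Q t]
    preserves this error. *)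
Lemma nonneg_supermartingale_sup (M : nat -> seq X -> R) c :
  (forall n, nonneg_supermartingale (M n)) ->
  (forall n t, M n t <= M n.+1 t) -> (forall n t, M n t <= c) ->
  nonneg_supermartingale (fun t => sup (range (M^~ t))).
Proof.
move=> sM Mup Mc.
have Mmono t : {homo M^~ t : m n / (m <= n)%N >-> m <= n}.
  by apply: homo_leq => //; exact: le_trans.
have Msup n t : M n t <= sup (range (M^~ t)).
  by apply: ub_le_sup; [exists c => _ [m _ <-]|exists n].
split=> t; last by apply: le_trans (Msup 0 t); case: (sM 0) => _.
apply/ler_addgt0Pr => e e0.
have [n nP] : exists n, forall x, sup (range (M^~ (rcons t x))) <= M n (rcons t x) + e.
  apply: finite_eventually => x.
  have [|_ [n _ <-]] := @sup_adherent _ (range (M^~ (rcons t x))) e e0.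
    by split; [exists (M 0 (rcons t x)), 0|exists c => _ [m _ <-]].
  move=> Mn; exists n => m nm; rewrite -lerBlDr; apply: (le_trans (ltW Mn)).
  exact: Mmono.
apply: le_trans (upper_le_shift (hQ t) nP) _; rewrite lerD2r.
by apply: le_trans (Msup n t); case: (sM n) => + _; exact.
Qed.

Lemma covers_le M f g s t :
  cylinder t `<=` cylinder s -> (forall w, cylinder t w -> g w <= f w) ->
  covers M f s -> covers M g t.
Proof. by move=> ts gf Mf w tw a ag; apply: Mf (ts _ tw) _ (lt_le_trans ag (gf _ tw)). Qed.

Lemma covers_cst f s c : (forall w, f w <= c) -> covers (fun=> c) f s.
Proof. by move=> fc w _ a af; exists 0%N => k _; exact: le_trans (ltW af) _. Qed.

Lemma cap_le M f s : nonneg_supermartingale M -> covers M f s -> cap f s <= M s.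
Proof.
move=> sM Mf; apply: ge_inf; last by exists M.
by exists 0 => _ [N [[_ N0] _] <-].
Qed.

Section Bounded.
Context (f : (nat -> X) -> R) (f1 : forall w, f w <= 1).

Let cap_nonempty s :
  [set M s | M in [set M | nonneg_supermartingale M /\ covers M f s]] !=set0.
Proof.
exists 1; exists (fun=> 1) => //; split; first exact: nonneg_supermartingale_cst.
exact: covers_cst.
Qed.

Lemma cap_lt s a : cap f s < a ->
  exists M, [/\ nonneg_supermartingale M, covers M f s & M s < a].
Proof. by move=> /inf_lt[//|_ [M [sM Mf] <-] Ma]; exists M. Qed.

Lemma cap_ge0 s : 0 <= cap f s.
Proof. by apply: lb_le_inf => // _ [M [[_ M0] _] <-]. Qed.

Lemma cap_le1 s : cap f s <= 1.
Proof.
by apply: (@cap_le (fun=> 1)); [exact: nonneg_supermartingale_cst|exact: covers_cst].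
Qed.

Lemma le_cap g s : (forall w, cylinder s w -> g w <= f w) -> cap g s <= cap f s.
Proof.
move=> gf; apply: lb_le_inf => // _ [M [sM Mf] <-]; apply: cap_le => //.
exact: covers_le Mf.
Qed.

(** A nearly optimal [M] for [s] covers [f] on each child as well, so it bounds [cap f] there, and
    its own supermartingale inequality carries the bound back to [s]. *)
Lemma cap_supermartingale : nonneg_supermartingale (cap f).
Proof.
split=> [s|]; last exact: cap_ge0.
apply/ler_addgt0Pr => e e0.
have /cap_lt[M [sM Mf Ma]] : cap f s < cap f s + e by rewrite ltrDl.
apply: le_trans (ltW Ma); apply: le_trans (sM.1 s).
apply: (upper_mono (hQ s)) => x; apply: cap_le => //.
exact: covers_le (@cylinder_rconsW _ _ _) _ Mf.
Qed.

End Bounded.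

(** * Switching between supermartingales at stopping situations *)

Section Switching.
Context (f : (nat -> X) -> R) (f1 : forall w, f w <= 1) (N : seq X -> R)
  (sN : nonneg_supermartingale N) (s : seq X).

Let switch u := (size s <= size u)%N && (cap f u < N u).

(** The shortest prefixes come first, so the head is the stopping situation and it never changes
    once it exists. *)
Let stops t := [seq u <- [seq take j t | j <- iota 0 (size t).+1] | switch u].

Let stops_rcons t x :
  stops (rcons t x) = stops t ++ [seq u <- [:: rcons t x] | switch u].
Proof.
rewrite /stops size_rcons -[_.+2]addn1 iotaD map_cat filter_cat add0n.
congr (_ ++ _); last by rewrite [map _ _]/= take_oversize ?size_rcons.
congr ([seq u <- _ | switch u]); apply/eq_in_map => j; rewrite mem_iota add0n ltnS /= => jt.
by rewrite -cats1 takel_cat.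
Qed.

Let stopsP t u : u \in stops t ->
  switch u /\ exists2 j, (j <= size t)%N & u = take j t.
Proof.
rewrite mem_filter => /andP[su /mapP[j]]; rewrite mem_iota add0n ltnS => /andP[_ jt] uj.
by split=> //; exists j.
Qed.

(* Follow [N] up to the first situation [u] where [cap f u < N u], and from
   there a supermartingale that starts below [N u] and covers [f]. *)
Lemma cap_switch :
  (forall w, cylinder s w ->
    (forall a, a < f w -> exists n, forall k, (n <= k)%N -> a <= N (prefix_of w k)) \/
    exists k, (size s <= k)%N /\ cap f (prefix_of w k) < N (prefix_of w k)) ->
  cap f s <= N s.
Proof.
move=> Nf.
have /choice[M MP] u : exists M, switch u ->
    [/\ nonneg_supermartingale M, covers M f u & M u < N u].
  have [|_] := boolP (switch u); last by exists N.
  by move=> /andP[_ /(cap_lt f1)[M ?]]; exists M.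
pose G t := if stops t is u :: _ then M u t else N t.
have stops_hd t u v : stops t = u :: v -> switch u.
  by move=> tuv; have /stopsP[] : u \in stops t by rewrite tuv mem_head.
have sG : nonneg_supermartingale G.
  split=> t; last first.
    rewrite /G; case Et : (stops t) => [|u v]; first exact: sN.2.
    by case: (MP u (stops_hd _ _ _ Et)) => -[].
  rewrite {2}/G; case Et : (stops t) => [|u v].
    apply: le_trans (sN.1 t); apply: (upper_mono (hQ t)) => x.
    (* At a child that is the first stop, the new supermartingale starts below [N], so switching
       only lowers the value. *)
    rewrite /G stops_rcons Et /=; case: ifP => // su.
    by case: (MP _ su) => _ _ /ltW.
  have [[+ _] _ _] := MP u (stops_hd _ _ _ Et); move=> /(_ t); apply: le_trans.
  by apply: (upper_mono (hQ t)) => x; rewrite /G stops_rcons Et.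
have GN : G s <= N s.
  rewrite /G; case Es : (stops s) => [//|u v].
  have [su [j js uj]] : switch u /\ exists2 j, (j <= size s)%N & u = take j s.
    by apply: stopsP; rewrite Es mem_head.
  (* A stop is at least as long as [s]; being a prefix of [s], it is [s] itself. *)
  have us : u = s.
    move: su => /andP[+ _]; rewrite uj size_take_min (minn_idPl js) => sj.
    by rewrite take_oversize.
  by rewrite us in su *; case: (MP _ su) => _ _ /ltW.
apply: le_trans GN; apply: cap_le => // w sw a af.
have stops_mono k u v : stops (prefix_of w k) = u :: v ->
    forall m, (k <= m)%N -> exists v', stops (prefix_of w m) = u :: v'.
  move=> Ek; elim=> [|m IH]; first by rewrite leqn0 => /eqP k0; exists v; rewrite -k0.
  rewrite leq_eqVlt => /predU1P[<-|]; first by exists v.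
  by rewrite ltnS => /IH[v' Em]; rewrite prefix_ofS stops_rcons Em; eexists.
have [[k stopk]|nostop] := pselect (exists k, stops (prefix_of w k) <> [::]).
  case Ek : (stops (prefix_of w k)) stopk => [//|u v] _.
  have [su [j jk uj]] : switch u /\ exists2 j, (j <= size (prefix_of w k))%N
      & u = take j (prefix_of w k).
    by apply: stopsP; rewrite Ek mem_head.
  have [_ Mf _] := MP _ su.
  have uw : cylinder u w.
    rewrite uj; rewrite size_prefix_of in jk; rewrite take_prefix_of//.
    exact: cylinder_prefix_of.
  have [n nP] := Mf _ uw _ af.
  exists (maxn n k) => m; rewrite geq_max => /andP[nm km].
  by rewrite /G; have [v' ->] := stops_mono _ _ _ Ek _ km; exact: nP.
have stops0 k : stops (prefix_of w k) = [::] by apply: contrapT => ?; apply: nostop; exists k.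
have [/(_ _ af)[n nP]|[k [sk kN]]] := Nf _ sw.
  by exists n => k nk; rewrite /G stops0; exact: nP.
have : prefix_of w k \in stops (prefix_of w k).
  rewrite mem_filter {1}/switch size_prefix_of sk kN andTb; apply/mapP; exists k.
    by rewrite mem_iota add0n /= ltnS.
  by rewrite take_oversize// size_prefix_of.
by rewrite stops0.
Qed.

End Switching.

Lemma cap_indic_le1 (A : set (nat -> X)) w : \1_A w <= 1 :> R.
Proof. by rewrite indicE lern1 leq_b1. Qed.

Lemma covers_indic (A : set (nat -> X)) M s : (forall t, 0 <= M t) ->
  (forall w, cylinder s w -> A w -> forall a, a < 1 ->
    exists n, forall k, (n <= k)%N -> a <= M (prefix_of w k)) ->
  covers M \1_A s.
Proof.
move=> M0 MA w sw a; have [Aw|nAw] := pselect (A w).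
  by rewrite indicE mem_set//; exact: MA.
rewrite indicE memNset// => a0; exists 0%N => k _; exact: le_trans (ltW a0) _.
Qed.

(** * Zero-one law for the capacity *)

Section Levy.
Context (f : (nat -> X) -> R) (f1 : forall w, f w <= 1) (a b : R)
  (a0 : 0 < a) (ab : a < b).

Let A := [set w | b < f w /\ forall n, exists k, (n <= k)%N /\ cap f (prefix_of w k) < a].
Let h := cap (\1_A).
(** A supremum over all situations, so that bounds on [h] valid everywhere can be fed back into
    it. *)
Let c := sup (range h).

Let hc t : h t <= c.
Proof.
apply: ub_le_sup; last by exists t.
by exists 1 => _ [u _ <-]; exact: cap_le1 (cap_indic_le1 _) _.
Qed.

Let b0 : 0 < b. Proof. exact: lt_trans ab. Qed.

Let c0 : 0 <= c.
Proof. by apply: le_trans (hc [::]); exact: cap_ge0 (cap_indic_le1 _) _. Qed.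

(* Below a situation where [cap f] is less than [a], bet on [f] until the stake
   has grown by [b / a], then switch to covering [A] at a price [c + e]. *)
Let cap_levy_low t e : 0 < e -> cap f t < a -> h t <= a / b * (c + e).
Proof.
move=> e0 /(cap_lt f1)[M [sM Mf Ma]].
have ce0 : 0 < c + e by rewrite ltr_wpDl.
have k0 : 0 <= (c + e) / b by rewrite divr_ge0// ltW.
have sN := nonneg_supermartingaleZ k0 sM.
apply: (@le_trans _ _ ((c + e) / b * M t)); last first.
  by rewrite [leRHS]mulrC [leRHS]mulrA [leRHS]mulrAC ler_wpM2l// ltW.
apply: (cap_switch (cap_indic_le1 _) sN) => w tw.
have [Aw|nAw] := pselect (A w); last first.
  left=> a'; rewrite indicE memNset// => a'0; exists 0%N => k _.
  by apply: le_trans (ltW a'0) _; exact: sN.2.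
right; have [n nP] := Mf _ tw _ Aw.1; exists (maxn n (size t)).
rewrite leq_maxr; split=> //; apply: (le_lt_trans (hc _)).
apply: (@lt_le_trans _ _ (c + e)); first by rewrite ltrDl.
rewrite mulrAC ler_pdivlMr// ler_wpM2l ?(ltW ce0)//.
by apply: nP; rewrite leq_maxl.
Qed.

(** Hold a constant until [cap f] falls below [a], which happens on every path of [A]; there
    [cap_levy_low] makes covering [A] cheaper. The final [e] makes this strict, as [cap_switch]
    demands. *)
Let cap_levy_step t e : 0 < e -> h t <= a / b * (c + e) + e.
Proof.
move=> e0.
have N0 : 0 <= a / b * (c + e) + e.
  by apply: addr_ge0 (ltW e0); rewrite mulr_ge0 ?divr_ge0 ?addr_ge0// ltW.
apply: (cap_switch (cap_indic_le1 _) (nonneg_supermartingale_cst N0)) => w tw.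
have [Aw|nAw] := pselect (A w); last first.
  by left=> a'; rewrite indicE memNset// => a'0; exists 0%N => k _; exact: le_trans (ltW a'0) _.
right; have [k [tk ka]] := Aw.2 (size t); exists k; split=> //.
by apply: le_lt_trans (cap_levy_low e0 ka) _; rewrite ltrDl.
Qed.

(** The previous bound, taken over all situations, reads [c <= a / b * (c + e) + e]; since
    [a / b < 1], letting [e] be small forces [c = 0]. *)
Lemma cap_levy s : cap (\1_A) s = 0.
Proof.
apply/eqP; rewrite eq_le (cap_ge0 (cap_indic_le1 _)) andbT.
apply: le_trans (hc s) _; rewrite leNgt; apply/negP => cpos.
have r1 : a / b < 1 by rewrite ltr_pdivrMr// mul1r.
(* Half of the gap: then [a / b * e < e] while [e + e = c - a / b * c], and the bound would give
   [c < c]. *)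
have e0 : 0 < (c - a / b * c) / 2 by rewrite divr_gt0// subr_gt0 gtr_pMl.
have : c <= a / b * (c + (c - a / b * c) / 2) + (c - a / b * c) / 2.
  by apply: ge_sup => [|_ [t _ <-]]; [exists (h [::]), [::]|exact: cap_levy_step].
have : a / b * ((c - a / b * c) / 2) < (c - a / b * c) / 2 by rewrite gtr_pMl.
set r := a / b; set e := _ / 2 => re; have ee : e + e = c - r * c by rewrite -splitr.
by clearbody r e; rewrite mulrDr => ce; lra.
Qed.

End Levy.

Section CountableUnion.
Context (A : nat -> set (nat -> X)) (s : seq X).

(** Sum covers of the [A i] whose prices at [s] are bounded by a geometric series of total [e]. *)
Lemma cap_bigcup0 : (forall i, cap \1_(A i) s = 0) -> cap \1_(\bigcup_i A i) s = 0.
Proof.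
move=> A0; apply/eqP; rewrite eq_le (cap_ge0 (cap_indic_le1 _)) andbT.
apply/ler_addgt0Pr => e e0; rewrite add0r.
have /choice[T TP] i : exists M, [/\ nonneg_supermartingale M,
    covers M \1_(A i) s & M s < e / 2 ^+ i.+1].
  by apply: (cap_lt (cap_indic_le1 _)); rewrite A0 divr_gt0// exprn_gt0.
(* The cut at 1 keeps the suprema finite; it costs nothing, as an indicator only has to be covered
   at levels below 1. *)
pose S n t := Num.min (\sum_(i < n) T i t) 1.
have T0 i t : 0 <= T i t by case: (TP i) => -[].
have sS n : nonneg_supermartingale (S n).
  apply: nonneg_supermartingale_min => //.
  elim: n => [|n IH].
    under eq_fun do rewrite big_ord0; exact: nonneg_supermartingale_cst.
  under eq_fun do rewrite big_ord_recr /=.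
  by apply: nonneg_supermartingaleD => //; case: (TP n).
have SS n t : S n t <= S n.+1 t.
  rewrite /S big_ord_recr /= le_min !ge_min lexx orbT andbT.
  by rewrite lerDl T0.
have S1 n t : S n t <= 1 by rewrite ge_min lexx orbT.
have sG := nonneg_supermartingale_sup sS SS S1.
apply: (@le_trans _ _ (sup (range (S^~ s)))).
  apply: (@cap_le (fun t => sup (range (S^~ t)))) => //.
  apply: covers_indic => [|w sw [i _ Aiw] a a1]; first exact: sG.2.
  have [_ Ti _] := TP i.
  have [|n nP] := Ti w sw a; first by rewrite indicE mem_set.
  exists n => k nk; apply: (@le_trans _ _ (S i.+1 (prefix_of w k))).
    rewrite le_min (ltW a1) andbT big_ord_recr /=.
    by apply: (le_trans (nP _ nk)); rewrite lerDr sumr_ge0.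
  by apply: ub_le_sup; [exists 1 => _ [m _ <-]|exists i.+1].
apply: ge_sup => [|_ [n _ <-]]; first by exists (S 0%N s), 0%N.
rewrite ge_min; apply/orP; left.
apply: (@le_trans _ _ (e - e / 2 ^+ n)); last by rewrite gerBl divr_ge0 ?exprn_ge0// ltW.
elim: n => [|n IH]; first by rewrite big_ord0 expr0 divr1 subrr.
rewrite big_ord_recr /=; have [_ _ /ltW Ts] := TP n.
apply: le_trans (lerD IH Ts) _.
have -> : e / 2 ^+ n = e / 2 ^+ n.+1 + e / 2 ^+ n.+1.
  have -> : e / 2 ^+ n.+1 = e / 2 ^+ n / 2 by rewrite exprS invfM mulrA mulrAC.
  exact: splitr.
by rewrite opprD addrA subrK.
Qed.

End CountableUnion.

Lemma cap_indic0 s : cap \1_set0 s = 0.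
Proof.
apply/eqP; rewrite eq_le (cap_ge0 (cap_indic_le1 _)) andbT.
by apply: (@cap_le (fun=> 0)); [exact: nonneg_supermartingale_cst|exact: covers_indic].
Qed.

(** * Continuity of the capacity along increasing sequences *)

Section UpwardContinuity.
Context (f : (nat -> X) -> R) (F : nat -> (nat -> X) -> R)
  (f1 : forall w, f w <= 1) (F1 : forall n w, F n w <= 1)
  (F_up : forall n w, F n w <= F n.+1 w)
  (F_sup : forall w a, a < f w -> exists n, a < F n w).

Let E t := sup (range (fun n => cap (F n) t)).

Let E_nonneg_supermartingale : nonneg_supermartingale E.
Proof.
apply: (@nonneg_supermartingale_sup (fun n => cap (F n)) 1) => n.
- exact: cap_supermartingale.
- by move=> t; apply: le_cap => // w _.
- exact: cap_le1.
Qed.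

Let cap_le_E n t : cap (F n) t <= E t.
Proof. by apply: ub_le_sup; [exists 1 => _ [m _ <-]; exact: cap_le1|exists n]. Qed.

(* By the zero-one law, the limit inferior of [E] dominates [f] outside of a
   countable union of null sets. *)
Lemma cap_sup s a : a < cap f s -> exists n, a < cap (F n) s.
Proof.
move=> af; suff fE : cap f s <= E s.
  have [||_ [n _ <-] an] := @sup_gt _ (range (fun n => cap (F n) s)) a.
  - by exists (cap (F 0%N) s), 0%N.
  - exact: lt_le_trans af fE.
  - by exists n.
(* The exceptional sets of [cap_levy] for all [F n] and all rational levels [0 < p < q], enumerated
   by codes; the other codes give the empty set. *)
pose A i : set (nat -> X) := if unpickle i is Some (n, p, q) then
  if (0 < ratr p :> R) && (ratr p < ratr q :> R) then
    [set w | ratr q < F n w /\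
      forall m, exists k, (m <= k)%N /\ cap (F n) (prefix_of w k) < ratr p]
  else set0 else set0.
have A0 i : cap \1_(A i) s = 0.
  rewrite /A; case: (unpickle i : option (nat * rat * rat)) => [[[n p] q]|];
    last exact: cap_indic0.
  by case: ifP => [/andP[p0 pq]|_]; [exact: cap_levy|exact: cap_indic0].
apply/ler_addgt0Pr => e e0.
(* [T] covers all exceptional paths at a price below [e], so [E + T] will cover [f] everywhere. *)
have [T [sT TA Te]] : exists M, [/\ nonneg_supermartingale M,
    covers M \1_(\bigcup_i A i) s & M s < e].
  by apply: (cap_lt (cap_indic_le1 _)); rewrite cap_bigcup0.
have sET := nonneg_supermartingaleD E_nonneg_supermartingale sT.
apply: le_trans (_ : E s + T s <= _); last by rewrite lerD2l ltW.
apply: (cap_le sET) => w sw b bf.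
have [b0|b0] := ltP b 0.
  by exists 0%N => k _; apply: le_trans (ltW b0) _; exact: sET.2.
have [Aw|nAw] := pselect ((\bigcup_i A i) w).
  have [|n nP] := TA w sw b; first by rewrite indicE mem_set//; exact: lt_le_trans bf _.
  exists n => k nk; apply: le_trans (nP _ nk) _; rewrite lerDr.
  exact: E_nonneg_supermartingale.2.
(* Choose [b < p < q < f w]. Some [F n w] exceeds [q], and off the exceptional sets [cap (F n)] is
   eventually at least [p] along [w]. *)
have [q] := rat_in_itvoo bf; rewrite in_itv /= => /andP[bq qf].
have [p] := rat_in_itvoo bq; rewrite in_itv /= => /andP[bp pq].
have [n nf] := F_sup qf.
have : ~ forall m, exists k, (m <= k)%N /\ cap (F n) (prefix_of w k) < ratr p.
  move=> dips; apply: nAw; exists (pickle (n, p, q)) => //.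
  by rewrite /A pickleK (le_lt_trans b0 bp) pq.
move=> /existsNP[m mP]; exists m => k mk.
apply: (@le_trans _ _ (E (prefix_of w k))); last by rewrite lerDl; exact: sT.2.
apply: le_trans (cap_le_E n _); rewrite leNgt; apply/negP => ltb; apply: mP.
by exists k; split=> //; exact: lt_trans bp.
Qed.

End UpwardContinuity.

(** * Choquet's capacitability argument *)

Section Choquet.
Context (f : (nat -> X) -> R) (f0 : forall w, 0 <= f w) (f1 : forall w, f w <= 1)
  (C : (nat -> X) -> (nat -> nat) -> Prop) (q : nat -> R) (C_closed : seq_closed C)
  (Cf : forall w sigma, C w sigma -> q (sigma 0%N) < f w)
  (fC : forall w a, a < f w -> exists2 sigma, C w sigma & a < q (sigma 0%N)).

(** Including 0, the lower bound of [f], gives the empty family a harmless supremum. *)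
Let height (D : set (nat -> nat)) : R :=
  sup [set r | r = 0 \/ exists2 sigma, D sigma & r = q (sigma 0%N)].

Let height_nonempty D :
  [set r | r = 0 \/ exists2 sigma, D sigma & r = q (sigma 0%N)] !=set0.
Proof. by exists 0; left. Qed.

Let height_lt D a : 0 <= a -> a < height D -> exists2 sigma, D sigma & a < q (sigma 0%N).
Proof.
move=> a0 /sup_gt[//|_ [->|[sigma Dsigma ->] aq]]; last by exists sigma.
by rewrite ltNge a0.
Qed.

Let height_le D c : 0 <= c -> (forall sigma, D sigma -> q (sigma 0%N) <= c) -> height D <= c.
Proof. by move=> c0 Dc; apply: ge_sup => // _ [->//|[sigma /Dc + ->]]. Qed.

Let paths (T : set (nat -> X)) : set (nat -> nat) :=
  [set sigma | exists2 w, T w & C w sigma].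

Let le_height D T : D `<=` paths T -> forall sigma, D sigma -> q (sigma 0%N) <= height D.
Proof.
move=> DT sigma Dsigma; apply: ub_le_sup; last by right; exists sigma.
exists 1 => _ [->//|[tau /DT[w _ /Cf/ltW qf] ->]]; exact: le_trans (f1 w).
Qed.

Let height_ge0 D T : D `<=` paths T -> 0 <= height D.
Proof.
move=> DT; apply: ub_le_sup; last by left.
exists 1 => _ [->//|[tau /DT[w _ /Cf/ltW qf] ->]]; exact: le_trans (f1 w).
Qed.

Let bounded_by (u : seq nat) : set (nat -> nat) :=
  [set sigma | forall i, (i < size u)%N -> (sigma i <= nth 0%N u i)%N].

(** What is left of [f] when only witnesses bounded by [u] count; with [u] empty, nothing is
    lost. *)
Let restr (u : seq nat) w := height (bounded_by u `&` paths [set w]).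

Let restr_le1 (u : seq nat) w : restr u w <= 1.
Proof.
by apply: height_le => // sigma [_ [w' _ /Cf/ltW qf]]; exact: le_trans (f1 w').
Qed.

(** Each witness has a finite next coordinate, so [restr (rcons u n)] increases to [restr u] in [n],
    and upward continuity provides [n]. *)
Let restr_step s a (u : seq nat) : a < cap (restr u) s -> exists n, a < cap (restr (rcons u n)) s.
Proof.
apply: cap_sup => //.
- move=> n w; apply: height_le => [|sigma [us ws]]; first exact: height_ge0 (@subIsetr _ _ _).
  apply: le_height (@subIsetr _ _ _) _ _; split=> // i.
  rewrite size_rcons => iu; have := us i; rewrite size_rcons => /(_ iu)/leq_trans; apply.
  by rewrite !nth_rcons; case: ltngtP.
- move=> w b; have [b0 _|b0] := ltP b 0.
    by exists 0%N; apply: lt_le_trans b0 _; exact: height_ge0 (@subIsetr _ _ _).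
  move=> /(height_lt b0)[sigma [us ws] bq]; exists (sigma (size u)).
  apply: lt_le_trans bq _; apply: le_height (@subIsetr _ _ _) _ _; split=> // i.
  rewrite size_rcons ltnS nth_rcons; case: ltngtP => //.
  - by move=> iu _; exact: us.
  - by move=> ->.
Qed.

(* Choquet's capacitability argument: successive bounds [nu] on the coordinates
   of [sigma] lose nothing above [a], and what they leave is compact. *)
Lemma cap_compact_approx s a : a < cap f s -> exists K : seq X -> R,
  [/\ forall t, 0 <= K t <= 1,
      forall t x, K (rcons t x) <= K t,
      forall w r, f w < r -> exists k, K (prefix_of w k) <= r &
      forall k, a < cap (fun w => K (prefix_of w k)) s].
Proof.
move=> af.
have [||nu nuP] := @seq_extend _ (fun u : seq nat => a < cap (restr u) s).
- apply: (lt_le_trans af); apply: le_cap => // w sw.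
  rewrite leNgt; apply/negP => /fC[sigma Cw]; apply/negP; rewrite -leNgt.
  by apply: le_height (@subIsetr _ _ _) _ _; split=> //; exists w.
- by move=> u; exact: restr_step.
(* Only the path's first [size t] states are fixed and only as many witness coordinates are bounded;
   both constraints tighten along a path. *)
pose K t := height (bounded_by (mkseq nu (size t)) `&` paths (cylinder t)).
have K0 t : 0 <= K t by exact: height_ge0 (@subIsetr _ _ _).
have K1 t : K t <= 1.
  by apply: height_le => // sigma [_ [w' _ /Cf/ltW qf]]; exact: le_trans (f1 w').
exists K; split.
- by move=> t; rewrite K0 K1.
- move=> t x; apply: height_le => // sigma [us [w tw Cw]].
  apply: le_height (@subIsetr _ _ _) _ _; split.
    move=> i; rewrite size_mkseq => it; have := us i.
    by rewrite size_mkseq size_rcons !nth_mkseq ?(ltnW it)//; [apply; exact: ltnW|exact: ltnW].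
  by exists w => //; exact: cylinder_rconsW tw.
- move=> w r fr; apply: contrapT => /forallNP rK.
  have r0 : 0 <= r by exact: le_trans (f0 w) (ltW fr).
  (* If [K] stayed above [r] along [w], longer and longer prefixes of [w] would have bounded
     witnesses of height above [r]. König's lemma merges them into a witness for [w] itself, against
     [f w < r]; the height depends on one coordinate, so the added condition is closed. *)
  have [||sigma [Cw qr]] := @koenig _ (fun w sigma => C w sigma /\ r < q (sigma 0%N)) nu w.
  + move=> w' sigma C'; split.
      by apply: C_closed => m; have [w1 [s1 [? ? [? _]]]] := C' m; exists w1, s1.
    by have [w1 [s1 [_ /(_ 0%N)<-// [_ ?]]]] := C' 1%N.
  + move=> k; have /height_lt : r < K (prefix_of w k) by rewrite ltNge; exact/negP.
    move=> /(_ r0)[sigma [us [w' ww' Cw']] rq]; exists w', sigma; split=> //.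
    * move=> i ik; have /(congr1 (fun u => nth point u i)) : prefix_of w' k = prefix_of w k.
        by have := cylinderE ww'; rewrite size_prefix_of.
      by rewrite !nth_mkseq.
    * by move=> i ik; have := us i; rewrite size_mkseq size_prefix_of nth_mkseq//; exact.
  by have := lt_trans qr (Cf Cw); rewrite ltNge (ltW fr).
- move=> k; apply: lt_le_trans (nuP k) _; apply: le_cap => // w _.
  apply: height_le => // sigma [us [_ -> Cw]].
  apply: le_height (@subIsetr _ _ _) _ _; rewrite size_prefix_of; split=> //.
  by exists w => //; exact: cylinder_prefix_of.
Qed.

End Choquet.

(** * Backward recursion for finitary functions and its limit *)

Section Backward.
Context (K : seq X -> R) (K01 : forall t, 0 <= K t <= 1)
  (K_anti : forall t x, K (rcons t x) <= K t).

Fixpoint backward j t : R :=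
  if j is j'.+1 then Q t (fun x => backward j' (rcons t x)) else K t.

Let K0 t : 0 <= K t. Proof. by case/andP: (K01 t). Qed.

Lemma backward_ge0 j t : 0 <= backward j t.
Proof.
elim: j t => [|j IH] t //=.
have <- : Q t (fun=> 0 * 0) = 0 by rewrite (upper_scale (hQ t) (fun=> 0))// mul0r.
by apply: (upper_mono (hQ t)) => x; rewrite mul0r.
Qed.

Lemma backward_anti j t : backward j.+1 t <= backward j t.
Proof.
elim: j t => [|j IH] t; last by apply: (upper_mono (hQ t)) => x; exact: IH.
by apply: (upper_le_bound (hQ t)) => x; exact: K_anti.
Qed.

Lemma cap_le_backward s k : (size s <= k)%N ->
  cap (fun w => K (prefix_of w k)) s <= backward (k - size s) s.
Proof.
move=> sk; pose V t := backward (k - size t) (take k t).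
have -> : backward (k - size s) s = V s by rewrite /V take_oversize.
apply: (@cap_le V).
  split=> t; last exact: backward_ge0.
  have [tk|kt] := ltnP (size t) k.
    rewrite /V [take k t]take_oversize ?(ltnW tk)// -subSS subSn// /=.
    apply: (upper_mono (hQ t)) => x.
    by rewrite size_rcons take_oversize ?size_rcons.
  apply: (upper_le_bound (hQ t)) => x.
  rewrite /V size_rcons; move: (kt) (leqW kt) => /eqP -> /eqP ->.
  by rewrite -cats1 takel_cat.
move=> w sw a /ltW aK; exists k => m km; rewrite /V size_prefix_of take_prefix_of//.
by move: km => /eqP ->.
Qed.

Let W t := inf (range (backward^~ t)).

Let W_le j t : W t <= backward j t.
Proof. by apply: ge_inf; [exists 0 => _ [i _ <-]; exact: backward_ge0|exists j]. Qed.

Let le_W c t : (forall j, c <= backward j t) -> c <= W t.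
Proof. by move=> cW; apply: lb_le_inf => [|_ [j _ <-]//]; exists (backward 0 t), 0%N. Qed.

(** The recursions decrease in [j], because [K] decreases along paths. Their infimum keeps the
    recursive inequality: one [j] is within [e] of the limit at all children at once. *)
Lemma cap_backward_limit s a :
  (forall k, a < cap (fun w => K (prefix_of w k)) s) ->
  exists W : seq X -> R, [/\ a <= W s, forall t, 0 <= W t <= K t &
    forall t, W t <= Q t (fun x => W (rcons t x))].
Proof.
move=> aK; exists W; split.
- apply: le_W => j; apply: le_trans (ltW (aK (size s + j)%N)) _.
  have := @cap_le_backward s (size s + j) (leq_addr _ _).
  by rewrite addKn.
- by move=> t; rewrite (W_le 0) andbT; apply: le_W => j; exact: backward_ge0.
- move=> t; apply/ler_addgt0Pr => e e0.
  have [j jP] : exists j, forall x, backward j (rcons t x) <= W (rcons t x) + e.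
    apply: finite_eventually => x.
    have [||_ [j _ <-] We] := @inf_lt _ (range (backward^~ (rcons t x))) (W (rcons t x) + e).
    + by exists (backward 0 (rcons t x)), 0%N.
    + by rewrite ltrDl.
    + exists j => m jm; apply: le_trans (ltW We).
      have : {homo backward^~ (rcons t x) : m n / (m <= n)%N >-> n <= m}.
        by apply: homo_leq => // [y z u zy yu|i]; [exact: le_trans yu zy|exact: backward_anti].
      exact.
  by apply: le_trans (upper_le_shift (hQ t) jP); exact: W_le j.+1 t.
Qed.

End Backward.

End Capacity.

(** * Nearly optimal compatible precise trees *)

Section NearOptimal.
Context {R : realType} {X : finPointedType} (P : seq X -> set (X -> R))
  (Q : seq X -> (X -> R) -> R) (hPQ : agree P Q).

Lemma agree_attained t h e : 0 < e ->
  exists2 q, P t q & Q t h - e <= \sum_(x : X) h x * q x.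
Proof.
move=> e0; have : ((Q t h - e)%:E < (Q t h)%:E)%E by rewrite lte_fin gtrBl.
by rewrite hPQ => /ereal_sup_gt[_ [q Pq <-]]; rewrite lte_fin => /ltW; exists q.
Qed.

Lemma agree_le t h q : P t q -> \sum_(x : X) h x * q x <= Q t h.
Proof. by move=> Pq; rewrite -lee_fin hPQ; apply: ereal_sup_ubound; exists q. Qed.

(** The loss allowed at a situation halves with each level, so the losses along a path add up to at
    most [e]. *)
Lemma compatible_submartingale W e : 0 < e ->
  (forall t, W t <= Q t (fun x => W (rcons t x))) ->
  exists2 p, compatible p P & forall t,
    W t - e / 2 ^+ (size t).+1 <= \sum_(x : X) W (rcons t x) * p t x.
Proof.
move=> e0 WQ.
have /choice[p pP] t : exists q, P t q /\
    W t - e / 2 ^+ (size t).+1 <= \sum_(x : X) W (rcons t x) * q x.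
  have e1 : 0 < e / 2 ^+ (size t).+1 by rewrite divr_gt0// exprn_gt0.
  have [q Pq Wq] := agree_attained t (fun x => W (rcons t x)) e1.
  by exists q; split=> //; apply: le_trans Wq; rewrite lerD2r.
by exists p => t; case: (pP t).
Qed.

End NearOptimal.

(** * Path measures *)

Section PathMeasureExists.
Context {R : realType} {X : finPointedType} (m : seq X -> R)
  (m_nil : m [::] = 1) (m_ge0 : forall z, 0 <= m z)
  (m_rcons : forall z, \sum_(x : X) m (rcons z x) = m z).

(* The situations [z] index nested intervals of length [m z]: those of the
   children of [z] partition the interval of [z]. Sending [r] to the path whose
   intervals contain it carries Lebesgue measure to the desired measure. *)
Let below z (x : X) := \sum_(y : X | (enum_rank y < enum_rank x)%N) m (rcons z y).

Let low z := \sum_(0 <= i < size z) below (take i z) (nth point z i).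

Let itv_of z : set R := `[low z, low z + m z[%classic.

Let low_rcons z x : low (rcons z x) = low z + below z x.
Proof.
rewrite /low size_rcons big_nat_recr //= nth_rcons ltnn eqxx -cats1 take_size_cat//.
congr +%R; apply: eq_big_nat => i /andP[_ iz].
by rewrite takel_cat ?(ltnW iz)// nth_cat iz.
Qed.

Let below_ge0 z x : 0 <= below z x. Proof. by apply: sumr_ge0. Qed.

Let below_lt z x y : (enum_rank x < enum_rank y)%N ->
  below z x + m (rcons z x) <= below z y.
Proof.
move=> xy; rewrite /below [leRHS](bigD1 x)//= [leLHS]addrC lerD2l.
rewrite [leLHS]big_mkcond [leRHS]big_mkcond /=; apply: ler_sum => u _.
case: ifP => ux; last by case: ifP.
by rewrite (ltn_trans ux xy) /=; case: eqP ux => [->|//]; rewrite ltnn.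
Qed.

Let below_le z x : below z x + m (rcons z x) <= m z.
Proof.
rewrite -(m_rcons z) [leRHS](bigD1 x)//= [leLHS]addrC lerD2l.
rewrite /below [leLHS]big_mkcond [leRHS]big_mkcond /=; apply: ler_sum => u _.
case: ifP => ux; last by case: ifP.
by case: eqP ux => [->|//]; rewrite ltnn.
Qed.

Let itv_of_rcons z x : itv_of (rcons z x) `<=` itv_of z.
Proof.
move=> r; rewrite /itv_of /= !in_itv /= low_rcons => /andP[lr rl]; apply/andP; split.
  by apply: le_trans lr; rewrite lerDl.
by apply: lt_le_trans rl _; rewrite -addrA lerD2l.
Qed.

Let itv_of_inj z x y r : itv_of (rcons z x) r -> itv_of (rcons z y) r -> x = y.
Proof.
wlog xy : x y / (enum_rank x < enum_rank y)%N.
  move=> H xr yr; have [xy|yx|/ord_inj/enum_rank_inj//] := ltngtP (enum_rank x) (enum_rank y).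
    exact: H xr yr.
  by apply/esym; exact: H yr xr.
rewrite /itv_of /= !in_itv /= !low_rcons => /andP[_ rx] /andP[yr _].
have := le_lt_trans yr rx; rewrite -addrA ltrD2l => /lt_le_trans/(_ (below_lt _ xy)).
by rewrite ltxx.
Qed.

(** Take the child of least rank whose interval ends to the right of [r]; the last child ends where
    [z] does, so one exists. If its interval also began to the right of [r], its predecessor would
    qualify. *)
Let itv_of_cover z r : itv_of z r -> exists x, itv_of (rcons z x) r.
Proof.
rewrite /itv_of /= in_itv /= => /andP[lr rl].
have ex : exists i, [exists x, (enum_rank x == i :> nat) &&
    (r < low z + below z x + m (rcons z x))].
  have n0 : (#|X|.-1 < #|X|)%N by rewrite prednK//; apply/card_gt0P; exists point.
  exists #|X|.-1; apply/existsP; exists (enum_val (Ordinal n0)).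
  rewrite enum_valK eqxx /=; apply: lt_le_trans rl _; rewrite -addrA lerD2l -(m_rcons z).
  rewrite [leLHS](bigD1 (enum_val (Ordinal n0)))//= addrC lerD2r /below.
  rewrite [leRHS]big_mkcond [leLHS]big_mkcond /=; apply: ler_sum => u _.
  rewrite enum_valK /= -[X in (_ < X)%N]/(#|X|.-1).
  case: ifP => un; last by case: ifP.
  rewrite ifT// ltn_neqAle -ltnS (ltn_predK n0) ltn_ord andbT.
  apply: contra un => /eqP un; rewrite -(enum_rankK u); apply/eqP; congr enum_val.
  exact/val_inj.
have [i /existsP[x /andP[/eqP xi rx]] imin] := ex_minnP ex.
exists x; rewrite in_itv /= low_rcons rx andbT leNgt; apply/negP => rlow.
have [i0|i0] := posnP i.
  move: rlow; rewrite /below big_pred0 ?addr0 ?ltNge ?lr// => y.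
  by rewrite xi i0 ltn0.
have i1 : (i.-1 < #|X|)%N by apply: leq_ltn_trans (leq_pred i) _; rewrite -xi.
have := imin i.-1; rewrite leqNgt prednK// leqnn => /(_ _)/negP; apply => //.
apply/existsP; exists (enum_val (Ordinal i1)); rewrite enum_valK eqxx /=.
apply: lt_le_trans rlow _; rewrite -addrA lerD2l /below.
rewrite [leLHS](bigD1 (enum_val (Ordinal i1)))/=; last by rewrite enum_valK xi /= prednK.
rewrite addrC lerD2r [leRHS]big_mkcond [leLHS]big_mkcond /=; apply: ler_sum => u _.
rewrite enum_valK /= xi; case: ifP => [/andP[ui un]|_]; last by case: ifP.
rewrite ifT// ltn_neqAle -ltnS prednK// ui andbT.
apply: contra un => /eqP un; rewrite -(enum_rankK u); apply/eqP; congr enum_val.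
exact/val_inj.
Qed.

(** Choosing covering children gives a path whose intervals all contain [r], and disjointness of
    siblings yields the converse. Outside the root interval a constant path is the default. *)
Let path_of : {T : R -> nat -> X | (forall r z, itv_of [::] r ->
    cylinder z (T r) <-> itv_of z r) /\ forall r, ~ itv_of [::] r -> T r = fun=> point}.
Proof.
apply: cid.
have /choice[T TP] r : exists w : nat -> X,
    (itv_of [::] r -> forall n, itv_of (mkseq w n) r) /\ (~ itv_of [::] r -> w = fun=> point).
  have [r0|r0] := pselect (itv_of [::] r); last by exists (fun=> point).
  have [|w wP] := @seq_extend _ (fun z => itv_of z r) r0; first by move=> z; exact: itv_of_cover.
  by exists w.
exists T; split=> r; last exact: (TP r).2.
move=> z /(TP r).1 rT; split=> [zT|]; first by rewrite -[z]zT; exact: rT.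
elim/last_ind: z => [//|z x IH] zx.
have /IH zT := itv_of_rcons zx.
rewrite /cylinder /= size_rcons prefix_ofS zT; congr rcons.
apply: (@itv_of_inj z _ _ r) => //.
by have := rT (size z).+1; rewrite mkseqS -/(prefix_of _ _) zT.
Qed.

Let T : measurableTypeR R -> path_space X := sval path_of.

Let measurable_T : measurable_fun setT T.
Proof.
have [TP T0] := svalP path_of.
apply: (@measurability _ _ _ _ setT T (range (@cylinder X))) => // _ [_ [z _ <-] <-].
rewrite setTI.
have -> : T @^-1` cylinder z = (itv_of z `&` itv_of [::]) `|`
    (~` itv_of [::] `&` [set _ | cylinder z (fun=> point)]).
  apply/seteqP; split=> r /=.
    have [r0|r0] := pselect (itv_of [::] r); first by move=> /(TP _ _ r0) ?; left.
    by rewrite /T T0// => ?; right.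
  move=> [[rz r0]|[r0]]; first by apply/(TP _ _ r0).
  by rewrite /T T0.
apply: measurableU; first by apply: measurableI; exact: measurable_itv.
apply: measurableI; first by apply: measurableC; exact: measurable_itv.
have [c|nc] := pselect (cylinder z (fun=> point)).
  by rewrite (_ : [set _ | _] = setT)//; apply/seteqP; split.
by rewrite (_ : [set _ | _] = set0)//; apply/seteqP; split.
Qed.

HB.instance Definition _ := isMeasurableFun.Build _ _ _ _ T measurable_T.

Let uniform01 : probability (measurableTypeR R) R :=
  mnormalize (mrestr lebesgue_measure (measurable_itv `[0%R, 1%R[)) point.

Let itv_of_nil : itv_of [::] = `[0, 1[%classic.
Proof. by rewrite /itv_of /low big_geq// m_nil add0r. Qed.

Let itv_of_sub z : itv_of z `<=` itv_of [::].
Proof.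
elim/last_ind: z => [//|z x IH]; exact: subset_trans (@itv_of_rcons _ _) IH.
Qed.

Let uniform01E I : uniform01 I = lebesgue_measure (I `&` `[0, 1[%classic).
Proof.
have m1 : mrestr (@lebesgue_measure R) (measurable_itv `[0%R, 1%R[) setT = 1%E.
  by rewrite /mrestr setTI lebesgue_measure_itv /= lte01 oppr0 adde0.
by rewrite /uniform01 /= /mnormalize /= m1 onee_eq0 /= invr1 mule1.
Qed.

Lemma path_measure_exists : exists mu : probability (path_space X) R,
  forall z, mu (cylinder z) = (m z)%:E.
Proof.
exists (distribution uniform01 T) => z.
rewrite [LHS]uniform01E.
have -> : T @^-1` cylinder z `&` `[0, 1[%classic = itv_of z.
  rewrite -itv_of_nil; have [TP _] := svalP path_of.
  apply/seteqP; split=> r /= => [[+ r0]|rz]; first by move/(TP _ _ r0).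
  by have r0 := itv_of_sub rz; split=> //; apply/(TP _ _ r0).
rewrite lebesgue_measure_itv /= lte_fin ltrDl.
case: ifPn => [_|]; first by rewrite -EFinB addrAC subrr add0r.
by rewrite -leNgt => mz; congr EFin; apply/eqP; rewrite eq_le m_ge0.
Qed.

End PathMeasureExists.

Section LimnEinf.
Context {R : realType}.
Implicit Types (u : nat -> \bar R) (x : \bar R).
Local Open Scope ereal_scope.

Lemma limn_einfE u : limn_einf u = ereal_sup (range (einfs u)).
Proof. by rewrite limn_einf_lim; apply/cvg_lim => //; exact: cvg_einfs_sup. Qed.

Lemma lt_limn_einf u x : x < limn_einf u ->
  exists n, forall k, (n <= k)%N -> x <= u k.
Proof.
rewrite limn_einfE => /ereal_sup_gt[_ [n _ <-] /ltW xn]; exists n => k nk.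
by apply: le_trans xn _; apply: ereal_inf_lbound; exists k.
Qed.

Lemma limn_einf_le u x : (forall n, u n <= x) -> limn_einf u <= x.
Proof.
move=> ux; rewrite limn_einfE; apply: ge_ereal_sup => _ [n _ <-].
by apply: le_trans (ux n); apply: ereal_inf_lbound; exists n => /=.
Qed.

Lemma le_limn_einf u x :
  (forall r : R, r%:E < x -> exists n, forall k, (n <= k)%N -> r%:E <= u k) ->
  x <= limn_einf u.
Proof.
move=> xu; have rP r : r%:E < x -> r%:E <= limn_einf u.
  move=> /xu[n nP]; rewrite limn_einfE.
  apply: (@le_trans _ _ (einfs u n)); last by apply: ereal_sup_ubound; exists n.
  by apply: le_ereal_inf_tmp => _ [k /= nk <-]; exact: nP.
case: x rP {xu} => [x| |] rP; last exact: leNye.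
- by apply/lee_subgt0Pr => e e0; apply: rP; rewrite lte_fin ltrBlDr ltrDl.
- by rewrite leye_eq; apply/eqP/eqyP => A _; apply: rP; rewrite ltry.
Qed.

End LimnEinf.

Section PathMeasure.
Context {R : realType} {X : finPointedType} (p : seq X -> X -> R)
  (p_pmf : forall t, is_pmf (p t)) (s : seq X).

Lemma cylinder_prob_ge0 z : 0 <= cylinder_prob p s z.
Proof.
rewrite /cylinder_prob; case: ifP => _; last by case: ifP.
by apply: prodr_ge0 => i _; case: (p_pmf (take i z)).
Qed.

Lemma cylinder_prob_refl : cylinder_prob p s s = 1.
Proof. by rewrite /cylinder_prob ltnn leqnn take_size eqxx. Qed.

Lemma cylinder_prob_geE z : (size s <= size z)%N -> cylinder_prob p s z =
  (take (size s) z == s)%:R * \prod_(size s <= i < size z) p (take i z) (nth point z i).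
Proof.
rewrite /cylinder_prob leq_eqVlt => /predU1P[zs|sz].
  rewrite zs ltnn leqnn /= big_geq// mulr1 -zs take_size zs take_size eq_sym.
  by case: eqP.
by rewrite sz leqNgt sz /=; case: eqP => _; rewrite ?mul1r ?mul0r.
Qed.

Lemma cylinder_prob_rcons z x : (size s <= size z)%N ->
  cylinder_prob p s (rcons z x) = cylinder_prob p s z * p z x.
Proof.
move=> sz; rewrite !cylinder_prob_geE ?size_rcons ?(leqW sz)// -mulrA; congr *%R.
  by rewrite -cats1 takel_cat.
have tz : take (size z) (rcons z x) = z by rewrite -cats1 take_size_cat.
rewrite big_nat_recr//= nth_rcons ltnn eqxx tz; congr *%R.
apply: eq_big_nat => i /andP[_ iz].
by rewrite -cats1 takel_cat ?(ltnW iz)// nth_cat iz.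
Qed.

Lemma sum_cylinder_prob_rcons z :
  \sum_(x : X) cylinder_prob p s (rcons z x) = cylinder_prob p s z.
Proof.
have [sz|zs] := leqP (size s) (size z).
  under eq_bigr do rewrite cylinder_prob_rcons//.
  by rewrite -mulr_sumr (p_pmf z).2 mulr1.
(* Strictly before [s], all mass goes to the one child on the way to [s]. *)
have E x : cylinder_prob p s (rcons z x) =
    if x == nth point s (size z) then cylinder_prob p s z else 0.
  rewrite /cylinder_prob size_rcons ltnS leqNgt zs /= (ltnW zs) ltnNge (ltnW zs) /=.
  rewrite (take_nth point zs) eqseq_rcons.
  by have [_|_] := eqVneq x (nth point s (size z)); rewrite ?andbT ?andbF.
under eq_bigr do rewrite E.
by rewrite -big_mkcond big_pred1_eq.
Qed.

Lemma path_measure_cylinder z :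
  path_measure p s (cylinder z) = (cylinder_prob p s z)%:E.
Proof.
have ex : exists mu : probability (path_space X) R,
    forall z, mu (cylinder z) = (cylinder_prob p s z)%:E.
  apply: path_measure_exists; [|exact: cylinder_prob_ge0|exact: sum_cylinder_prob_rcons].
  by rewrite /cylinder_prob /= take0 eqxx.
exact: (getPex ex).
Qed.

End PathMeasure.

Section Measurability.
Context {X : finPointedType}.

Lemma measurable_cylinder z : measurable (cylinder z : set (path_space X)).
Proof. by apply: sub_sigma_algebra; exists z. Qed.

Lemma measurable_finitary d (Y : measurableType d) (g : seq X -> Y) k :
  measurable_fun setT (fun w : path_space X => g (prefix_of w k)).
Proof.
move=> _ B _; rewrite setTI.
have -> : (fun w : path_space X => g (prefix_of w k)) @^-1` B =
    \bigcup_z (if `[< size z = k /\ B (g z) >] then cylinder z else set0).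
  apply/seteqP; split=> [w /= Bw|w [z _]].
    exists (prefix_of w k) => //; rewrite size_prefix_of.
    by case: asboolP => [_|[]//]; exact: cylinder_prefix_of.
  by case: asboolP => [[zk Bz]|//] /cylinderE wz; rewrite /= -zk wz.
apply: countable_bigcupT_measurable; first exact: countableP.
by move=> z; case: asboolP => _ //; exact: measurable_cylinder.
Qed.

End Measurability.

(** * Integrals of finitary functions and Fatou's lemma on paths *)

Section PathIntegral.
Context {R : realType} {X : finPointedType} (p : seq X -> X -> R)
  (p_pmf : forall t, is_pmf (p t)) (s : seq X).

Let mu := path_measure p s.

Fixpoint tree_expectation (G : seq X -> R) n t : R :=
  if n is n'.+1 then \sum_(x : X) tree_expectation G n' (rcons t x) * p t x else G t.

Let cylinder_bigU z : cylinder z =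
  \big[setU/set0]_(x <- index_enum X) cylinder (rcons z x).
Proof.
apply/seteqP; split=> w.
  move=> zw; rewrite -bigcup_seq; exists (w (size z)) => /=.
    exact: mem_index_enum.
  by rewrite /cylinder /= size_rcons prefix_ofS zw.
by rewrite -bigcup_seq => -[x _]; exact: cylinder_rconsW.
Qed.

(** The cylinder of [z] is the disjoint union of those of its children, which turns the integral
    into the recursion of [tree_expectation]. *)
Lemma integral_cylinder_finitary (G : seq X -> R) n z : (forall t, 0 <= G t) ->
  (size s <= size z)%N ->
  (\int[mu]_(w in cylinder z) (G (prefix_of w (size z + n)))%:E =
   (cylinder_prob p s z * tree_expectation G n z)%:E)%E.
Proof.
move=> G0; elim: n z => [|n IH] z sz.
  rewrite (eq_integral (cst (G z)%:E)); last first.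
    by move=> w; rewrite inE addn0 => zw; rewrite zw.
  rewrite integral_cst; last exact: measurable_cylinder.
  by rewrite muleC [X in (X * _)%E](path_measure_cylinder p_pmf) -EFinM.
rewrite [in LHS]cylinder_bigU ge0_integral_bigsetU; first last.
- by move=> w _; rewrite lee_fin.
- apply: measurable_funTS.
  exact: (measurable_finitary (fun t => (G t)%:E)).
- apply/trivIsetP => x y _ _ xy; apply/seteqP; split=> // w [].
  rewrite /cylinder /= !size_rcons !prefix_ofS => /rcons_inj[_ wx] /rcons_inj[_ wy].
  by move: xy; rewrite -wx wy eqxx.
- exact: index_enum_uniq.
- by move=> x; exact: measurable_cylinder.
rewrite mulr_sumr -sumEFin; apply: eq_bigr => x _.
have := IH (rcons z x); rewrite size_rcons addSnnS => ->; last exact: leqW.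
by rewrite cylinder_prob_rcons// -mulrA [p z x * _]mulrC.
Qed.

Lemma integral_path_measure (f : path_space X -> \bar R) :
  measurable_fun setT f -> (forall w, (0 <= f w)%E) ->
  (\int[mu]_(w in setT) f w = \int[mu]_(w in cylinder s) f w)%E.
Proof.
move=> mf f0; have ms := measurable_cylinder s.
have muC : mu (~` (cylinder s : set (path_space X))) = 0%E.
  rewrite probability_setC// [X in (_ - X)%E](path_measure_cylinder p_pmf).
  by rewrite cylinder_prob_refl subee.
rewrite (ge0_negligible_integral _ _ mf _ muC)//; last exact: measurableC.
by rewrite setDE setCK setTI.
Qed.

Lemma integral_finitary (G : seq X -> R) n : (forall t, 0 <= G t) ->
  (\int[mu]_(w in setT) (G (prefix_of w (size s + n)))%:E =
   (tree_expectation G n s)%:E)%E.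
Proof.
move=> G0; rewrite integral_path_measure.
- by rewrite integral_cylinder_finitary// cylinder_prob_refl mul1r.
- exact: (measurable_finitary (fun t => (G t)%:E)).
- by move=> w; rewrite lee_fin.
Qed.

Lemma tree_expectation_le (G H : seq X -> R) n t : (forall t, G t <= H t) ->
  (forall t, \sum_(x : X) H (rcons t x) * p t x <= H t) ->
  tree_expectation G n t <= H t.
Proof.
move=> GH HH; elim: n t => [//|n IH] t /=; apply: le_trans (HH t).
by apply: ler_sum => x _; rewrite ler_wpM2r//; case: (p_pmf t).
Qed.

(** Fatou's lemma for [G] read at depths [size s + n], where the integrals are tree expectations. *)
Lemma integral_le_liminf (G : seq X -> R) (f : path_space X -> \bar R) (r : R) :
  (forall t, 0 <= G t) -> measurable_fun setT f -> (forall w, (0 <= f w)%E) ->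
  (forall w, cylinder s w ->
    (f w <= limn_einf (fun k => (G (prefix_of w k))%:E))%E) ->
  (forall n, tree_expectation G n s <= r) ->
  (\int[mu]_(w in setT) f w <= r%:E)%E.
Proof.
move=> G0 mf f0 fG Gr.
pose g n (w : path_space X) := (G (prefix_of w (size s + n)))%:E.
have mg n : measurable_fun setT (g n) by exact: (measurable_finitary (fun t => (G t)%:E)).
have g0 n w : (0 <= g n w)%E by rewrite lee_fin.
have mlim : measurable_fun setT (fun w => limn_einf (g^~ w)).
  apply: measurableT_comp => //; apply: measurable_fun_limn_esup => n.
  exact: measurableT_comp.
have fg w : cylinder s w -> (f w <= limn_einf (g^~ w))%E.
  move=> /fG/le_trans; apply; apply: le_limn_einf => a /lt_limn_einf[n nP].
  by exists n => k nk; apply: nP; exact: leq_trans nk (leq_addl _ _).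
have lim0 w : (0 <= limn_einf (g^~ w))%E.
  by apply: le_limn_einf => a a0; exists 0%N => k _; exact: le_trans (ltW a0) _.
rewrite integral_path_measure//.
apply: (@le_trans _ _ (\int[mu]_(w in cylinder s) limn_einf (g^~ w))%E).
  apply: ge0_le_integral => //; first exact: measurable_cylinder.
  - exact: measurable_funTS.
  - exact: measurable_funTS.
rewrite -integral_path_measure//.
apply: le_trans (fatou _ _ mg _) _ => //.
by apply: limn_einf_le => n; rewrite integral_finitary// lee_fin.
Qed.

End PathIntegral.

(** * Duality *)

Section IntegralFacts.
Local Open Scope ereal_scope.
Context d (T : measurableType d) (R : realType) (mu : probability T R).

Lemma integral_affine (phi : T -> R) (a k : R) : measurable_fun setT phi ->
  (forall w, 0 <= phi w <= 1)%R ->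
  \int[mu]_w (a + k * phi w)%:E = a%:E + k%:E * \int[mu]_w (phi w)%:E.
Proof.
move=> mphi phi01.
have iphi : mu.-integrable setT (EFin \o phi).
  apply: measurable_bounded_integrable => //.
    by rewrite (le_lt_trans (probability_le1 _ _))// ltry.
  exists 1%R; split=> // M M1 w _; case/andP: (phi01 w) => phi0 phi1.
  by rewrite /= ger0_norm// (le_trans phi1)// ltW.
have ia : mu.-integrable setT (fun _ : T => a%:E) by exact: finite_measure_integrable_cst.
have ikphi : mu.-integrable setT (fun w => k%:E * (phi w)%:E) by exact: integrableZl.
under eq_integral do rewrite EFinD EFinM.
rewrite integralD// integralZl//; congr (_ + _).
by rewrite (integral_cst mu measurableT a%:E) [X in _ * X]probability_setT mule1.
Qed.

(** Positive and negative parts are compared separately, which also covers infinite integrals. *)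
Lemma le_integral_measurable (f g : T -> \bar R) : measurable_fun setT f ->
  measurable_fun setT g -> (forall w, f w <= g w) ->
  \int[mu]_w f w <= \int[mu]_w g w.
Proof.
move=> mf mg fg; rewrite integralE [leRHS]integralE; apply: leeB.
- apply: ge0_le_integral => //; [exact: measurable_funepos|exact: measurable_funepos|].
  by move=> w _; apply: (@funepos_le _ _ setT); rewrite ?inE.
- apply: ge0_le_integral => //; [exact: measurable_funeneg|exact: measurable_funeneg|].
  by move=> w _; apply: (@funeneg_le _ _ setT); rewrite ?inE.
Qed.

(** Truncation at [n] leaves the negative part unchanged, and its integral is finite because [f] is
    bounded below; Fatou's lemma then handles the positive parts. *)
Lemma integral_le_truncations (f : T -> \bar R) (y : \bar R) :
  bounded_below f -> measurable_fun setT f ->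
  (forall n, \int[mu]_w mine (f w) n%:R%:E <= y) -> \int[mu]_w f w <= y.
Proof.
move=> [b bf] mf fy.
have mfn n : measurable_fun setT (fun w => mine (f w) n%:R%:E).
  by apply: measurable_mine => //; exact: measurable_cst.
have negE n w : (fun w => mine (f w) n%:R%:E)^\- w = f^\- w.
  rewrite !funenegE; have [//|nf] := leP (f w) n%:R%:E.
  have f0 : 0 <= f w by rewrite (le_trans _ (ltW nf))// lee_fin.
  by rewrite !max_r// leeNl oppe0// lee_fin.
have neg_fin : \int[mu]_w f^\- w \is a fin_num.
  rewrite ge0_fin_numE; last by apply: integral_ge0.
  apply: (@le_lt_trans _ _ (\int[mu]_w (cst `|b|%:E) w)).
    apply: ge0_le_integral => //; [exact: measurable_funeneg|].
    move=> w _; rewrite funenegE ge_max lee_fin normr_ge0 andbT leeNl.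
    apply: le_trans (bf w); rewrite -EFinN lee_fin lerNl -normrN; exact: ler_norm.
  by rewrite integral_cst// [X in _ * X]probability_setT mule1 ltry.
have pos_le n : \int[mu]_w (fun w => mine (f w) n%:R%:E)^\+ w <= y + \int[mu]_w f^\- w.
  rewrite -leeBlDr//; have := fy n; rewrite integralE.
  by under [X in _ - X]eq_integral do rewrite negE.
rewrite integralE leeBlDr//.
apply: (@le_trans _ _ (\int[mu]_w
    limn_einf (fun n => (fun w => mine (f w) n%:R%:E)^\+ w))).
  apply: ge0_le_integral => //; [exact: measurable_funepos| |].
  - apply: measurableT_comp => //; apply: measurable_fun_limn_esup => n.
    by apply: measurableT_comp => //; exact: measurable_funepos.
  - move=> w _; apply: le_limn_einf => r rf.
    have [n rn] : exists n, (r <= n%:R)%R.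
      by exists (Num.truncn r).+1; exact/ltW/truncnS_gt.
    exists n => k nk; rewrite funeposE le_max le_min.
    move: rf; rewrite funeposE lt_max => /orP[/ltW ->|/ltW ->]; last by rewrite orbT.
    by rewrite lee_fin (le_trans rn)// ler_nat.
apply: le_trans (fatou _ _ _ _) _ => //; first by move=> n; exact: measurable_funepos.
exact: limn_einf_le.
Qed.

End IntegralFacts.

Section Duality.
Context {R : realType} {X : finPointedType} (P : seq X -> set (X -> R))
  (Q : seq X -> (X -> R) -> R) (hP : is_imprecise_tree P)
  (hQ : is_upper_expectation_tree Q) (hPQ : agree P Q) (s : seq X).
Implicit Types (f : path_space X -> \bar R) (M : seq X -> R).

Let compatible_pmf p : compatible p P -> forall t, is_pmf (p t).
Proof. by move=> pP t; have [_ _ _] := hP t; apply; exact: pP. Qed.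

(** Choquet's approximation costs [e / 2], the choice of [p] another [e / 2]. The integral of [phi]
    is bounded from below by applying Fatou's lemma to [1 - phi]. *)
Lemma cap_le_integral (phi : path_space X -> R) e : 0 < e ->
  measurable_fun setT phi -> (forall w, 0 <= phi w <= 1) ->
  exists2 p, compatible p P &
    ((cap Q phi s - e)%:E <= \int[path_measure p s]_w (phi w)%:E)%E.
Proof.
move=> e0 mphi phi01.
have phi0 w : 0 <= phi w by case/andP: (phi01 w).
have phi1 w : phi w <= 1 by case/andP: (phi01 w).
have h0 : 0 < e / 2 by rewrite divr_gt0.
have [r|C [q [C_closed Cphi phiC]]] := @analytic_subgraph _ _ phi.
  have := mphi measurableT _ (measurable_itv `]r, +oo[); rewrite setTI.
  by congr measurable; apply/seteqP; split=> w /=; rewrite in_itv /= andbT.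
have ae : cap Q phi s - e / 2 < cap Q phi s by rewrite ltrBlDr ltrDl.
have [K [K01 K_anti phiK capK]] :=
  @cap_compact_approx _ _ Q hQ phi phi0 phi1 C q C_closed Cphi phiC s _ ae.
have [W [Ws WK WQ]] := cap_backward_limit hQ K01 K_anti capK.
have [p pP pW] := compatible_submartingale hPQ h0 WQ.
exists p => //; have pmf := compatible_pmf pP.
have mN : measurable_fun setT (fun w : path_space X => (1 + (- 1) * phi w)%:E).
  apply/measurable_EFinP; apply: measurable_funD; first exact: measurable_cst.
  by apply: measurable_funM => //; exact: measurable_cst.
have : (\int[path_measure p s]_w (1 + (- 1) * phi w)%:E <= (1 - (cap Q phi s - e))%:E)%E.
  apply: (@integral_le_liminf _ _ p pmf s (fun t => 1 - K t)) => //.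
  - by move=> t; rewrite subr_ge0; case/andP: (K01 t).
  - by move=> w; rewrite lee_fin mulN1r subr_ge0.
  - move=> w _; apply: le_limn_einf => a; rewrite lte_fin mulN1r => aphi.
    have [|k kP] := phiK w (1 - a); first by rewrite ltrBrDr -ltrBrDl.
    exists k => m km; rewrite lee_fin lerBrDr -lerBrDl; apply: le_trans kP.
    move: km; elim: m => [|m IH]; first by rewrite leqn0 => /eqP ->.
    rewrite leq_eqVlt => /predU1P[<-//|]; rewrite ltnS => /IH; apply: le_trans.
    by rewrite prefix_ofS.
  (* [H] dominates [1 - K] and is a supermartingale for [p]: the halving of its last term pays for
     the loss of [W] at each step. *)
  - move=> n; pose H t := 1 - W t + e / 2 / 2 ^+ size t.
    apply: (@le_trans _ _ (H s)).
      apply: tree_expectation_le => // t; rewrite /H.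
        have /andP[_ WKt] := WK t.
        by rewrite -[leLHS]addr0 lerD ?lerB// divr_ge0 ?exprn_ge0// ltW.
      under eq_bigr => x _ do rewrite mulrDl mulrBl mul1r size_rcons.
      rewrite big_split sumrB /= -mulr_sumr (pmf t).2 mulr1.
      have e2 : e / 2 / 2 ^+ size t = e / 2 / 2 ^+ (size t).+1 + e / 2 / 2 ^+ (size t).+1.
        have -> : e / 2 / 2 ^+ (size t).+1 = e / 2 / 2 ^+ size t / 2.
          by rewrite exprS invfM mulrA [in LHS]mulrAC.
        exact: splitr.
      rewrite e2; have := pW t; set A := \sum_(x : X) _; set B := _ / 2 ^+ _.
      clearbody A B; move=> ?; lra.
    have : e / 2 / 2 ^+ size s <= e / 2.
      rewrite ler_pdivrMr ?exprn_gt0// ler_peMr ?(ltW h0)//.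
      by rewrite exprn_ege1// ler1n.
    rewrite /H; set B := _ / 2 ^+ _; clearbody B; move: Ws => Ws Be; lra.
rewrite integral_affine//.
case: (\int[path_measure p s]_w (phi w)%:E)%E => [i| |]; last 2 first.
- by rewrite leey.
- by rewrite EFinN mulN1e.
by rewrite -EFinM -EFinD !lee_fin => ?; lra.
Qed.

(** By agreement, [M] is also a supermartingale for the compatible [p], so Fatou's lemma applies. *)
Lemma integral_le_supermartingale p M (phi : path_space X -> R) a k c :
  compatible p P -> measurable_fun setT phi -> (forall w, 0 <= phi w <= 1) ->
  0 <= k -> supermartingale Q M -> (forall t, c <= M t) ->
  (forall w, cylinder s w ->
    ((a + k * phi w)%:E <= limn_einf (fun k => (M (prefix_of w k))%:E))%E) ->
  (\int[path_measure p s]_w (a + k * phi w)%:E <= (M s)%:E)%E.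
Proof.
move=> pP mphi phi01 k0 sM cM phiM; have pmf := compatible_pmf pP.
(* Subtracting [d] makes both the integrand and [M] nonnegative. *)
pose d := Num.min a c.
have : (\int[path_measure p s]_w (a - d + k * phi w)%:E <= (M s - d)%:E)%E.
  apply: (@integral_le_liminf _ _ p pmf s (fun t => M t - d)).
  - by move=> t; rewrite subr_ge0 (le_trans _ (cM t))// ge_min lexx orbT.
  - apply/measurable_EFinP; apply: measurable_funD; first exact: measurable_cst.
    by apply: measurable_funM => //; exact: measurable_cst.
  - move=> w; rewrite lee_fin addr_ge0 ?subr_ge0 ?ge_min ?lexx// mulr_ge0//.
    by case/andP: (phi01 w).
  - move=> w sw; apply: le_limn_einf => r; rewrite lte_fin => rphi.
    have [|n nP] := @lt_limn_einf _ _ (r + d)%:E (lt_le_trans _ (phiM w sw)).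
      by rewrite lte_fin -ltrBrDr addrAC.
    by exists n => m /nP; rewrite !lee_fin lerBrDr.
  - move=> n; apply: (@tree_expectation_le _ _ p pmf _ (fun t => M t - d)) => // t.
    under eq_bigr do rewrite mulrBl.
    rewrite sumrB -mulr_sumr (pmf t).2 mulr1 lerB//.
    by apply: le_trans (sM t); exact: agree_le.
rewrite !integral_affine// (EFinB (M s)) leeBrDr// addeAC -EFinD subrK.
exact.
Qed.


Lemma truncation_affine f (b c : R) : measurable_fun setT f ->
  (forall w, (b%:E <= f w)%E) ->
  exists a k (phi : path_space X -> R), [/\ 0 < k, measurable_fun setT phi,
    forall w, 0 <= phi w <= 1 & forall w, mine (f w) c%:E = (a + k * phi w)%:E].
Proof.
(* The truncation takes values between [min b c] and [c]; the extra 1 keeps [k] positive when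
   [c <= b]. *)
move=> mf bf; pose a := Num.min b c; pose k := c - a + 1.
have ac : a <= c by rewrite ge_min lexx orbT.
have k0 : 0 < k by rewrite ltr_wpDl// subr_ge0.
have mfc : measurable_fun setT (fun w => mine (f w) c%:E).
  by apply: measurable_mine => //; exact: measurable_cst.
have fc_fin w : mine (f w) c%:E \is a fin_num.
  rewrite fin_numE; apply/andP; split; last by rewrite -ltey gt_min ltry orbT.
  by rewrite -ltNye lt_min (lt_le_trans (ltNyr b))// ltNyr.
exists a, k, (fun w => k^-1 * (fine (mine (f w) c%:E) - a)); split => //.
- apply: measurable_funM; first exact: measurable_cst.
  apply: measurable_funB; last exact: measurable_cst.
  exact: measurableT_comp.
- move=> w; rewrite mulrC divr_ge0 ?(ltW k0)//=; last first.
    rewrite subr_ge0 -lee_fin fineK// le_min lee_fin ac andbT.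
    by apply: le_trans (bf w); rewrite lee_fin ge_min lexx.
  rewrite ler_pdivrMr// mul1r /k ler_wpDr// lerD2r -lee_fin fineK//.
  by rewrite ge_min lexx orbT.
- by move=> w; rewrite mulrA divff ?gt_eqF// mul1r subrKC fineK.
Qed.

Lemma upper_Ep_measurable p f : bounded_below f -> measurable_fun setT f ->
  upper_Ep p f s = (\int[path_measure p s]_w f w)%E.
Proof.
move=> bf mf; apply/eqP; rewrite eq_le; apply/andP; split.
  by apply: ereal_inf_lbound; exists f.
apply: le_ereal_inf_tmp => _ [g [_ mg fg] <-]; exact: le_integral_measurable.
Qed.

Lemma upper_EG_gamble_le_affine (phi : path_space X -> R) a k :
  (forall w, 0 <= phi w <= 1) -> 0 < k ->
  (upper_EG_gamble Q (fun w => (a + k * phi w)%:E) s <= (a + k * cap Q phi s)%:E)%E.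
Proof.
move=> phi01 k0; have phi1 w : phi w <= 1 by case/andP: (phi01 w).
apply/lee_addgt0Pr => e e0.
have ek : 0 < e / k by rewrite divr_gt0.
have [M [sM Mphi Ms]] : exists M, [/\ nonneg_supermartingale Q M, covers M phi s &
    M s < cap Q phi s + e / k] by apply: (cap_lt hQ phi1); rewrite ltrDl.
apply: (@le_trans _ _ (a + k * M s)%:E).
  apply: ereal_inf_lbound; exists (fun t => a + k * M t) => //; split.
  - move=> t; have [skM _] := nonneg_supermartingaleZ hQ (ltW k0) sM.
    have := skM t; rewrite addrC -(lerD2r a); apply: le_trans.
    by apply: (@upper_le_shift _ _ _ (hQ t) _ (fun x => k * M (rcons t x))) => x; rewrite addrC.
  - by exists a => t; rewrite lerDl mulr_ge0 ?(ltW k0)//; exact: sM.2.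
  - move=> w sw; apply: le_limn_einf => r; rewrite lte_fin -ltrBlDl -ltr_pdivrMl//.
    move=> /(Mphi w sw)[n nP]; exists n => m /nP.
    by rewrite lee_fin ler_pdivrMl// lerBlDl.
rewrite -EFinD lee_fin -addrA lerD2l.
apply: le_trans (ler_wpM2l (ltW k0) (ltW Ms)) _.
by rewrite mulrDr mulrCA divff ?gt_eqF// mulr1.
Qed.

Lemma upper_EG_gamble_truncation_le f c : bounded_below f -> measurable_fun setT f ->
  (upper_EG_gamble Q (fun w => mine (f w) c%:E) s <= upper_EP P f s)%E.
Proof.
move=> bf mf; have [b fb] := bf.
have [a [k [phi [k0 mphi phi01 fphi]]]] := truncation_affine c mf fb.
under [X in upper_EG_gamble Q X]eq_fun do rewrite fphi.
apply: le_trans (upper_EG_gamble_le_affine a phi01 k0) _.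
apply/lee_addgt0Pr => e e0; have ek : 0 < e / k by rewrite divr_gt0.
have [p pP pphi] := cap_le_integral ek mphi phi01.
apply: (@le_trans _ _ (\int[path_measure p s]_w f w + e%:E)%E); last first.
  rewrite leeD2r// -upper_Ep_measurable//.
  by apply: ereal_sup_ubound; exists p.
apply: (@le_trans _ _ (\int[path_measure p s]_w (a + k * phi w)%:E + e%:E)%E); last first.
  rewrite leeD2r//; apply: le_integral_measurable => //.
  - apply/measurable_EFinP; apply: measurable_funD; first exact: measurable_cst.
    by apply: measurable_funM => //; exact: measurable_cst.
  - by move=> w; rewrite -fphi ge_min lexx.
rewrite integral_affine//.
apply: (@le_trans _ _ (a%:E + k%:E * (cap Q phi s - e / k)%:E + e%:E)%E); last first.
  by rewrite leeD2r// leeD2l// lee_pmul2l.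
rewrite -EFinM -!EFinD lee_fin mulrBr mulrCA divff ?gt_eqF// mulr1.
by rewrite addrA subrK.
Qed.

Lemma integral_truncation_le p f c : compatible p P -> bounded_below f ->
  measurable_fun setT f ->
  (\int[path_measure p s]_w mine (f w) c%:E <=
   upper_EG_gamble Q (fun w => mine (f w) c%:E) s)%E.
Proof.
move=> pP [b fb] mf.
have [a [k [phi [k0 mphi phi01 fphi]]]] := truncation_affine c mf fb.
apply: le_ereal_inf_tmp => _ [M [sM [m mM] Mf] <-].
under eq_integral do rewrite fphi.
apply: (@integral_le_supermartingale _ _ _ _ _ m) => //; first exact: ltW.
by move=> w sw; rewrite -fphi; exact: Mf.
Qed.

Lemma le_upper_EG_gamble f g : (forall w, (f w <= g w)%E) ->
  (upper_EG_gamble Q f s <= upper_EG_gamble Q g s)%E.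
Proof.
move=> fg; apply: le_ereal_inf => _ [M [sM bM Mg] <-]; exists M => //; split => // w sw.
exact: le_trans (fg w) (Mg w sw).
Qed.

Lemma upper_EG_bounded_belowE f : upper_EG_bounded_below Q f s =
  ereal_sup (range (fun c : R => upper_EG_gamble Q (fun w => mine (f w) c%:E) s)).
Proof.
apply/cvg_lim => //; apply: nondecreasing_cvge => c d cd.
apply: le_upper_EG_gamble => w.
by rewrite le_min !ge_min lexx lee_fin cd !orbT.
Qed.

(** Once [c] is below a lower bound of [f], truncating from below changes nothing, so the limit is
    of an eventually constant function. *)
Lemma upper_EQE f : bounded_below f -> upper_EQ Q f s = upper_EG_bounded_below Q f s.
Proof.
move=> [b fb]; apply: lim_near_cst => //; near=> c.
congr (upper_EG_bounded_below Q _ s); apply/funext => w.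
rewrite max_l//; apply: le_trans (fb w); rewrite lee_fin.
by near: c; apply: nbhs_ninfty_le; exact: num_real.
Unshelve. all: by end_near. Qed.

End Duality.

Theorem theorem13 (R : realType) (X : finPointedType)
    (P : seq X -> set (X -> R)) (Q : seq X -> (X -> R) -> R)
    (hP : is_imprecise_tree P) (hQ : is_upper_expectation_tree Q)
    (hPQ : agree P Q)
    (s : seq X) (f : path_space X -> \bar R)
    (f_bb : bounded_below f) (f_meas : measurable_fun setT f) :
  upper_EP P f s = upper_EQ Q f s.
Proof.
rewrite upper_EQE// upper_EG_bounded_belowE; apply/eqP; rewrite eq_le; apply/andP; split.
  apply: ge_ereal_sup => _ [p pP <-]; rewrite upper_Ep_measurable//.
  apply: integral_le_truncations => // n.
  apply: le_trans (integral_truncation_le hP hPQ s n%:R pP f_bb f_meas) _.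
  by apply: ereal_sup_ubound; exists n%:R.
by apply: ge_ereal_sup => _ [c _ <-]; exact: upper_EG_gamble_truncation_le.
Qed.
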